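(* If $I\subset S=K[x_1,\ldots,x_n]$ is a nonzero ideal of Borel type, then $\mathrm{reg}(I^k)\leq k\cdot \mathrm{reg}(I)$ for any positive integer $k$.
   Context: $K$ is an infinite field, $n\geq 2$, and $S=K[x_1,\ldots,x_n]$ is the polynomial ring with its standard grading. A monomial ideal $I\subset S$ is of Borel type if $(I:x_j^\infty)=(I:(x_1,\ldots,x_j)^\infty)$ for all $j=1,\ldots,n$, where $(I:L^\infty)=\bigcup_{k\ge 1}(I:L^k)$ for an ideal $L$ and $(I:x_j^\infty)=(I:(x_j)^\infty)$. The (Castelnuovo-Mumford) regularity is $\mathrm{reg}(I)=\max\{j-i : \beta_{ij}(I)\neq 0\}$, where $\beta_{ij}(I)=\dim_K \mathrm{Tor}_i^S(I,K)_j$ are the graded Betti numbers of $I$. *)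

(* Defs.v *)
From mathcomp Require Import all_boot all_order all_algebra.
From mathcomp Require Import mpoly.
From mathcomp Require Import boolp classical_sets functions cardinality.

Set Implicit Arguments.
Unset Strict Implicit.
Unset Printing Implicit Defensive.

Import Order.TTheory GRing.Theory Num.Theory.
Local Open Scope ring_scope.
Local Open Scope classical_set_scope.

Section Ideals.
Variables (K : fieldType) (n : nat).
Local Notation S := {mpoly K[n]}.
Implicit Types (I L G : set S).

Definition ideal_gen G : set S :=
  [set f | exists m (a g : 'I_m -> S),
      (forall i, G (g i)) /\ f = \sum_(i < m) a i * g i].

Definition ideal_pow I (k : nat) : set S :=
  ideal_gen [set f | exists2 g : 'I_k -> S,
                       (forall i, I (g i)) & f = \prod_(i < k) g i].

Definition ideal_colon I L : set S := [set f | forall g, L g -> I (f * g)].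

Definition ideal_sat I L : set S :=
  \bigcup_(k in [set k | (1 <= k)%N]) ideal_colon I (ideal_pow L k).

Definition monomial_ideal I : Prop :=
  exists M : set 'X_{1..n}, I = ideal_gen [set 'X_[m] | m in M].

(* The variables are indexed from 0: 'X_i is x_(i+1). *)
Definition borel_type I : Prop :=
  monomial_ideal I /\
  forall j : 'I_n,
    ideal_sat I (ideal_gen [set 'X_j]) =
    ideal_sat I (ideal_gen [set 'X_i | i in [set i : 'I_n | (i <= j)%N]]).

End Ideals.

(* 0 is homogeneous of every degree, and nothing else is homogeneous of a
   negative degree. *)
Definition homogz (K : fieldType) (n : nat) (d : int) (f : {mpoly K[n]}) : Prop :=
  {in msupp f, forall m : 'X_{1..n}, (mdeg m)%:Z = d}.

(* Data of a sequence ... -> F_2 -> F_1 -> F_0 -> S of graded free modules of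
   finite rank, F_i having a basis (e_a) indexed by 'I_(frank i), with e_a in
   degree fdeg a.  Elements of F_i are row vectors of coordinates, and maps act
   by multiplication on the right. *)
Record free_sequence (K : fieldType) (n : nat) := FreeSequence {
  frank : nat -> nat;
  fdeg : forall i, 'I_(frank i) -> int;
  fdiff : forall i, 'M[{mpoly K[n]}]_(frank i.+1, frank i);
  faug : 'cV[{mpoly K[n]}]_(frank 0)
}.

Section Resolutions.
Variables (K : fieldType) (n : nat).
Local Notation S := {mpoly K[n]}.
Implicit Types (F : free_sequence K n) (I : set S) (i : nat) (j : int).

Definition graded_free_resolution F I : Prop :=
  [/\ (forall a, homogz (fdeg a) (faug F a ord0)),
      (forall i a b, homogz (fdeg a - fdeg b) (fdiff F i a b)),
      (forall f : S, I f <->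
         exists v : 'rV_(frank F 0), v *m faug F = f%:M),
      (forall v : 'rV_(frank F 0), v *m faug F = 0 <->
         exists w, v = w *m fdiff F 0) &
      (forall i (v : 'rV_(frank F i.+1)), v *m fdiff F i = 0 <->
         exists w, v = w *m fdiff F i.+1)].

(* F (x)_S K, where K = S / (x_1, ..., x_n): the S-module S (x)_S K is K, and
   multiplication by f induces multiplication by the constant term of f. *)
Definition tensor_diff F i : 'M[K]_(frank F i.+1, frank F i) :=
  map_mx (mcoeff 0%MM) (fdiff F i).

(* The row space of this matrix is the degree j component of F_i (x)_S K. *)
Definition tensor_deg F i j : 'M[K]_(frank F i) :=
  diag_mx (\row_a (fdeg a == j)%:R).

Definition tensor_cycles F i j : 'M[K]_(frank F i) :=
  match i with
  | 0 => tensor_deg F 0 j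
  | i'.+1 => (tensor_deg F i'.+1 j :&: kermx (tensor_diff F i'))%MS
  end.

Definition tensor_boundaries F i j : 'M[K]_(frank F i.+1, frank F i) :=
  tensor_deg F i.+1 j *m tensor_diff F i.

(* dim_K H_i(F (x)_S K)_j *)
Definition tor_dim F i j : nat :=
  (\rank (tensor_cycles F i j) - \rank (tensor_boundaries F i j))%N.

(* dim_K Tor_i^S(I, K)_j.  A homogeneous ideal I has a resolution as above, and
   the value does not depend on it; the default 0 is for the other sets. *)
Definition betti I i j : nat :=
  xget 0%N [set b | exists2 F, graded_free_resolution F I & b = tor_dim F i j].

(* The default 0 is for the sets without a maximum; for a nonzero homogeneous
   ideal the maximum exists. *)
Definition reg I : int :=
  let D := [set r | exists i j, betti I i j <> 0%N /\ r = j - i%:Z] in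
  xget 0 [set r | D r /\ forall s, D s -> s <= r].

End Resolutions.

(* Main.v *)
(* For a set U of monomials closed under multiples let (P_d) be the condition
     "u in K[x_1, ..., x_l], x_l u in U and deg u >= d imply u in U".
   A monomial ideal with monomials U that satisfies (P_d) has regularity at
   most d: in the Koszul complex of the ideal, the strand of multidegree a is
   the chain complex of a simplicial complex, which (P_d) makes, in the relevant
   dimensions, a cone with apex the largest index of the support of a.
   Conversely, if u violates (P_d) and has maximal degree with this property,
   then x^u times the boundary of e_1 /\ ... /\ e_l is a Koszul cycle of the
   ideal which is not a boundary, whence reg > deg u >= d.  Such a u of maximal
   degree exists for an ideal of Borel type, by Dickson's lemma.  So an ideal of
   Borel type satisfies (P_d) for d = reg I; then so do the monomials of I^k for
   kd, by exchanging variables in products of k elements of degree d.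

   That Koszul homology computes the Betti numbers of an arbitrary graded free
   resolution F is seen by a diagonal walk in the double complex of F and the
   Koszul complex; the resolution exists by Hilbert's basis theorem. *)

Require Import Defs.
From mathcomp Require Import all_boot all_order all_algebra.
From mathcomp Require Import mpoly zify.
From mathcomp Require Import boolp classical_sets functions cardinality.

Set Implicit Arguments.
Unset Strict Implicit.
Unset Printing Implicit Defensive.
Import Order.TTheory GRing.Theory Num.Theory.
Local Open Scope ring_scope.

(** * Dickson's lemma and Hilbert's basis theorem *)

Section Dickson.

(** After any index some value of [f] is least among all later ones; jumping repeatedly to such an
    index gives the subsequence. *)
Lemma nondecreasing_subseq (f : nat -> nat) :
  exists phi : nat -> nat, {homo phi : i j / (i < j)%N} /\
    {homo f \o phi : i j / (i <= j)%N}.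
Proof.
pose minafter i k := (i < k)%N /\ forall j, (i < j)%N -> (f k <= f j)%N.
have ex i : exists k, minafter i k.
  have [k [ik kmin]] : exists k, (i < k)%N /\ forall l, (i < l)%N -> (f k <= f l)%N.
    have: exists v, `[< exists2 k, (i < k)%N & f k = v >].
      by exists (f i.+1); apply/asboolP; exists i.+1.
    case/ex_minnP => v /asboolP [k ik <-] vmin.
    by exists k; split => // l il; apply: vmin; apply/asboolP; exists l.
  by exists k.
pose nxt i := projT1 (cid (ex i)).
have nxtP i : minafter i (nxt i) by rewrite /nxt; case: (cid _).
pose phi i := iter i.+1 nxt 0%N.
have phiS i : (phi i < phi i.+1)%N by have [] := nxtP (phi i).
have phi_homo : {homo phi : i j / (i < j)%N}.
  by apply: homo_ltn => //; exact: ltn_trans.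
exists phi; split => //.
apply: homo_leq => // [|i /=]; first exact: leq_trans.
have [_] := nxtP (iter i nxt 0%N); apply.
by apply: ltn_trans (phiS i); have [] := nxtP (iter i nxt 0%N).
Qed.

Lemma nondecreasing_subseq_mnm n (f : nat -> 'X_{1..n}) :
  exists phi : nat -> nat, {homo phi : i j / (i < j)%N} /\
    forall i j, (i <= j)%N -> (f (phi i) <= f (phi j))%MM.
Proof.
suff H (s : seq 'I_n) : exists phi : nat -> nat, {homo phi : i j / (i < j)%N} /\
    forall i j, (i <= j)%N -> {in s, forall k, (f (phi i) k <= f (phi j) k)%N}.
  have [phi [phi1 phi2]] := H (enum 'I_n); exists phi; split => // i j ij.
  by apply/mnm_lepP => k; apply: phi2 => //; rewrite mem_enum.
elim: s => [|k s [phi [phi1 phi2]]]; first by exists id; split.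
have [psi [psi1 psi2]] := nondecreasing_subseq (fun i => f (phi i) k).
exists (phi \o psi); split=> [i j ij|i j ij l]; first exact/phi1/psi1.
rewrite inE => /predU1P [->|ls]; first exact: psi2.
apply: phi2 => //; move: ij; rewrite leq_eqVlt => /predU1P [->//|ij].
exact/ltnW/psi1.
Qed.

(** Otherwise a greedy choice gives an infinite sequence in [M] with no term a multiple of an
    earlier one, against the nondecreasing subsequence. *)
Lemma dickson n (M : 'X_{1..n} -> Prop) :
  exists s : seq 'X_{1..n}, (forall g, g \in s -> M g) /\
    forall m, M m -> exists2 g, g \in s & (g <= m)%MM.
Proof.
apply: contrapT => nos.
have ex (s : seq 'X_{1..n}) : exists m, (forall g, g \in s -> M g) ->
    M m /\ forall g, g \in s -> ~~ (g <= m)%MM.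
  have [sM|] := pselect (forall g, g \in s -> M g); last by exists 0%MM.
  apply: contrapT => nom; apply: nos; exists s; split => // m Mm.
  apply: contrapT => nog; apply: nom; exists m => _; split => // g gs.
  by apply/negP => gm; apply: nog; exists g.
pose nxt s := projT1 (cid (ex s)).
pose bad i := iter i (fun s => rcons s (nxt s)) [::].
have badM i g : g \in bad i -> M g.
  elim: i g => [//|i IH] g /=; rewrite mem_rcons inE => /predU1P [->|/IH //].
  by rewrite /nxt; case: (cid _) => m /= /(_ IH) [].
have badN i g : g \in bad i -> ~~ (g <= nxt (bad i))%MM.
  by rewrite /nxt; case: (cid _) => m /= /(_ (@badM i)) [_]; apply.
have bad_in i j : (i < j)%N -> nxt (bad i) \in bad j.
  elim: j => // j IH; rewrite ltnS leq_eqVlt /= mem_rcons inE => /predU1P [->|/IH ->].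
    by rewrite eqxx.
  by rewrite orbT.
have [phi [phi1 phi2]] := nondecreasing_subseq_mnm (fun i => nxt (bad i)).
by have := badN _ _ (bad_in _ _ (phi1 0 1 isT)); rewrite phi2.
Qed.

End Dickson.

(** * Coefficients of monomial multiples and slices *)

Section Coefficients.
Variables (K : fieldType) (n : nat).
Local Notation S := {mpoly K[n]}.
Implicit Types (p q : S) (m k : 'X_{1..n}) (P : pred 'X_{1..n}).

Lemma mcoeffXM k p m :
  ('X_[k] * p)@_m = if (k <= m)%MM then p@_(m - k) else 0.
Proof.
case: ifPn => [km|nkm]; first by rewrite mulrC -{1}(submK km) addmC mcoeffMX.
apply: contraNeq nkm => nz.
have : m \in msupp (p * 'X_[k]) by rewrite mcoeff_msupp mulrC.
rewrite (perm_mem (msuppMX _ _)) => /mapP [l _ ->]; exact: lem_addr.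
Qed.

Lemma mcoeff_sum (I : Type) (r : seq I) (Q : pred I) (F : I -> S) m :
  (\sum_(i <- r | Q i) F i)@_m = \sum_(i <- r | Q i) (F i)@_m.
Proof. exact: raddf_sum. Qed.

(** Division by the monomial [k], keeping the quotient monomials in [P]. With [k = 0] it gives
    homogeneous components, with [k = U_(l)] the division by [x_l] in the Koszul homotopy. Degrees
    do not grow, so the bound [msize p] loses nothing. *)
Definition mslice P k p : S :=
  \sum_(m : 'X_{1..n < msize p}) (if P m then p@_(m + k) else 0) *: 'X_[m].

Lemma mcoeff_mslice P k p m :
  (mslice P k p)@_m = if P m then p@_(m + k) else 0.
Proof.
have [lt|le] := ltnP (mdeg m) (msize p).
  by rewrite /mslice (mcoeff_mpoly (fun m => if P m then p@_(m + k) else 0)).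
have -> : p@_(m + k) = 0.
  apply/memN_msupp_eq0/msize_mdeg_ge; apply: leq_trans le _.
  by rewrite mdegD leq_addr.
rewrite if_same /mslice mcoeff_sum big1 // => i _.
rewrite mcoeffZ mcoeffX; case: eqP => [E|]; last by rewrite mulr0.
by have := bmdeg i; rewrite E ltnNge le.
Qed.

End Coefficients.

(** * Hilbert's basis theorem for ideals and for submodules of free modules *)

Section Noetherian.
Variables (K : fieldType) (n : nat).
Local Notation S := {mpoly K[n]}.

(** Dickson's lemma gives finitely many elements whose leading monomials divide all others; division
    by them lowers the leading monomial, a well-founded process. *)
Lemma hilbert_basis (N : S -> Prop) :
    N 0 -> (forall a u v, N u -> N v -> N (a * u + v)) ->
  exists m (g : 'I_m -> S), (forall i, N (g i)) /\
    forall f, N f -> exists w : 'I_m -> S, f = \sum_i w i * g i.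
Proof.
move=> N0 ND.
have [s [sM sP]] := dickson (fun m => exists f, [/\ N f, f != 0 & mlead f = m]).
have exF m : exists f : S, m \in s -> [/\ N f, f != 0 & mlead f = m].
  by have [/sM [f ?]|_] := boolP (m \in s); [exists f|exists 0].
pose F m := projT1 (cid (exF m)).
have FP m : m \in s -> [/\ N (F m), F m != 0 & mlead (F m) = m].
  by rewrite /F; case: (cid _).
pose t := in_tuple s.
exists (size s), (fun i => F (tnth t i)); split => [i|f Nf].
  by have [] := FP _ (mem_tnth i t).
move: {2}(mlead f) (erefl (mlead f)) => m.
elim/(well_founded_ind (@ltom_wf n)): m f Nf => m IH f Nf fm.
have [->|f0] := eqVneq f 0.
  by exists (fun=> 0); rewrite big1 // => i _; rewrite mul0r.
have [g gs gf] : exists2 g, g \in s & (g <= mlead f)%MM by apply: sP; exists f.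
have [NF F0 Fg] := FP g gs.
have FL : mleadc (F g) != 0 by rewrite mleadc_eq0.
pose c := mleadc f / mleadc (F g); pose a : S := c *: 'X_[mlead f - g].
have c0 : c != 0 by rewrite mulf_neq0 ?invr_eq0 // mleadc_eq0.
pose f' := f - a * F g.
have Nf' : N f'.
  by rewrite /f' addrC -mulNr; apply: ND.
have a0 : a != 0 by rewrite mscalerI negb_or c0 -msupp_eq0 msuppX.
have La : mlead (a * F g) = mlead f.
  by rewrite mleadM // mleadZ // mleadXm Fg submK.
have f'0 : f'@_(mlead f) = 0.
  rewrite /f' mcoeffB /a -scalerAl mcoeffZ mcoeffXM lem_subr.
  by rewrite submBA // [(_ + g)%MM]addmC addmK -{1}Fg divfK ?subrr.
have [i ig] : exists i, g = tnth t i by apply/tnthP.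
have [w fw] : exists w : 'I_(size s) -> S, f' = \sum_i w i * F (tnth t i).
  have [f'z|f'nz] := eqVneq f' 0.
    by exists (fun=> 0); rewrite f'z big1 // => j _; rewrite mul0r.
  apply: (IH (mlead f')) => //; rewrite -fm lt_neqAle; apply/andP; split.
    by apply: contraNneq f'nz => E; rewrite -mleadc_eq0 E f'0.
  by have := mleadB_le f (a * F g); rewrite La joinxx.
exists (fun j => w j + (if j == i then a else 0)).
rewrite (eq_bigr (fun j => w j * F (tnth t j) + (if j == i then a * F g else 0))).
  by rewrite big_split /= -big_mkcond big_pred1_eq -fw subrK.
by move=> j _; rewrite mulrDl; case: eqP => [->|_]; rewrite -?ig ?mul0r.
Qed.

Definition submodule r (N : 'rV[S]_r -> Prop) :=
  N 0 /\ forall a u v, N u -> N v -> N (a *: u + v).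

(** By induction on the rank: the first coordinates form a finitely generated ideal, whose
    generators lift to [N], and the elements with first coordinate 0 form a submodule of smaller
    rank. *)
Lemma submodule_fg r (N : 'rV[S]_r -> Prop) : submodule N ->
  exists m (G : 'M[S]_(m, r)), forall v, N v <-> exists w, v = w *m G.
Proof.
elim: r N => [|r IH] N [N0 ND].
  exists 0, 0 => v; rewrite [v]thinmx0; split=> // _.
  by exists 0; rewrite mulmx0.
have [||m [g [gN gP]]] := @hilbert_basis (fun f => exists v : 'rV_r, N (row_mx f%:M v)).
- by exists 0; rewrite (_ : row_mx _ _ = 0) // -row_mx0; congr row_mx; rewrite raddf0.
- move=> a u v [u' uN] [v' vN]; exists (a *: u' + v').
  have -> : (a * u + v)%:M = a *: u%:M + v%:M :> 'M[S]_1.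
    by rewrite scale_scalar_mx raddfD.
  by rewrite -add_row_mx -scale_row_mx; apply: ND.
have [l lN] : exists l : 'I_m -> 'rV_r, forall i, N (row_mx (g i)%:M (l i)).
  by exists (fun i => projT1 (cid (gN i))) => i; case: (cid _).
have [|m' [G' GP]] := IH (fun v => N (row_mx (0 : 'M_1) v)).
  split=> [|a u v uN vN]; first by rewrite row_mx0.
  have -> : row_mx (0 : 'M_1) (a *: u + v) = a *: row_mx 0 u + row_mx 0 v :> 'rV[S]_(1 + r).
    by rewrite scale_row_mx add_row_mx scaler0 addr0.
  exact: ND.
pose G1 : 'M[S]_(m, 1 + r) := row_mx (\col_i g i) (\matrix_(i < m) l i).
exists (m + m')%N, (col_mx G1 (row_mx (0 : 'cV_m') G')) => v.
have sumN k (w : 'rV[S]_k) (H : 'M[S]_(k, r.+1)) :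
    (forall i, N (row i H)) -> N (w *m H).
  move=> HN; rewrite mulmx_sum_row.
  elim/big_ind: _ => //; last first.
    by move=> i _; rewrite -[_ *: _]addr0; apply: ND.
  by move=> x y Nx Ny; rewrite -[x]scale1r; apply: ND.
have G1N (w : 'rV_m) : N (w *m G1).
  apply: sumN => i; rewrite /G1 (@row_row_mx _ _ 1 r) rowK (_ : row i _ = (g i)%:M) //.
  by apply/matrixP => a b; rewrite !ord1 !mxE eqxx mulr1n.
split.
  rewrite -[v](@hsubmxK _ 1 1 r) => vN.
  pose f := (lsubmx (v : 'M_(1, 1 + r))) 0 0.
  have fE : lsubmx (v : 'M_(1, 1 + r)) = f%:M by apply: mx11_scalar.
  have [w fw] : exists w, f = \sum_i w i * g i.
    by apply: gP; exists (rsubmx (v : 'M_(1, 1 + r))); rewrite -fE.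
  pose w1 : 'rV_m := \row_i w i.
  pose t : 'M[S]_(1, 1 + r) := w1 *m G1.
  have tf : lsubmx t = f%:M.
    rewrite /t mul_mx_row row_mxKl; apply/matrixP => i j.
    by rewrite !ord1 fw !mxE eqxx mulr1n; apply: eq_bigr => k _; rewrite !mxE.
  have [w' w'P] : exists w', rsubmx (v : 'M_(1, 1 + r)) - rsubmx t = w' *m G'.
    apply/GP; suff -> : row_mx (0 : 'M_1) (rsubmx (v : 'M_(1, 1 + r)) - rsubmx t) =
        (-1) *: t + row_mx (lsubmx (v : 'M_(1, 1 + r))) (rsubmx (v : 'M_(1, 1 + r))).
      by apply: ND => //; exact: G1N.
    rewrite -[t in RHS](@hsubmxK _ 1 1 r) scale_row_mx add_row_mx !scaleN1r.
    by rewrite fE tf addNr [_ - _ in LHS]addrC.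
  exists (row_mx w1 w').
  rewrite mul_row_col (@mul_mx_row _ _ _ 1 r w') mulmx0 -w'P.
  have tE : w1 *m G1 = row_mx f%:M (rsubmx t) :> 'M_(1, 1 + r).
    by rewrite -tf hsubmxK.
  by rewrite tE (@add_row_mx _ 1 1 r) addr0 fE [rsubmx t + _]addrC subrK.
case=> w ->; rewrite -[w]hsubmxK mul_row_col -[lsubmx w *m _]scale1r.
apply: ND; first exact: G1N.
by rewrite (@mul_mx_row _ _ _ 1 r (rsubmx w)) mulmx0; apply/GP; exists (rsubmx w).
Qed.

End Noetherian.

(** * Graded free resolutions *)

Section Graded.
Variables (K : fieldType) (n : nat).
Local Notation S := {mpoly K[n]}.
Implicit Types (f g : S) (d e t : int).

Definition hcomp d f : S := mslice (fun m => (mdeg m)%:Z == d) 0%MM f.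

Lemma mcoeff_hcomp d f m :
  (hcomp d f)@_m = if (mdeg m)%:Z == d then f@_m else 0.
Proof. by rewrite mcoeff_mslice addm0. Qed.

Lemma homogzP d f :
  homogz d f <-> forall m : 'X_{1..n}, f@_m != 0 -> (mdeg m)%:Z = d.
Proof. by split=> H m; have := H m; rewrite mcoeff_msupp. Qed.

Lemma hcomp_homogz d f : homogz d (hcomp d f).
Proof.
by apply/homogzP => m; rewrite mcoeff_hcomp; case: ifP => [/eqP //|]; rewrite eqxx.
Qed.

Lemma hcomp0 d : hcomp d 0 = 0.
Proof. by apply/mpolyP => m; rewrite mcoeff_hcomp mcoeff0 if_same. Qed.

Lemma hcomp_sum (I : Type) (r : seq I) (P : pred I) d (F : I -> S) :
  hcomp d (\sum_(i <- r | P i) F i) = \sum_(i <- r | P i) hcomp d (F i).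
Proof.
apply/mpolyP => m; rewrite mcoeff_hcomp !mcoeff_sum.
case: ifP => E; first by apply: eq_bigr => i _; rewrite mcoeff_hcomp E.
by rewrite big1 // => i _; rewrite mcoeff_hcomp E.
Qed.

Lemma hcompM d e f g : homogz e g -> hcomp (d + e) (f * g) = hcomp d f * g.
Proof.
move=> ge; rewrite [g in LHS]mpolyE [g in RHS]mpolyE !mulr_sumr hcomp_sum.
rewrite !big_seq; apply: eq_bigr => m /ge gm.
apply/mpolyP => l; rewrite mcoeff_hcomp -!scalerAr !mcoeffZ [f * _]mulrC.
rewrite [_ * 'X_[_]]mulrC !mcoeffXM mcoeff_hcomp; case: (boolP (m <= l)%MM) => [ml|_].
  have -> : ((mdeg l)%:Z == d + e) = ((mdeg (l - m))%:Z == d).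
    by rewrite -{1}(submK ml) mdegD PoszD gm (inj_eq (addIr _)).
  by case: ifP => // _; rewrite mulr0.
by rewrite mulr0 if_same.
Qed.

Definition vcomp r (c : 'I_r -> int) t (v : 'rV[S]_r) : 'rV[S]_r :=
  \row_b hcomp (t - c b) (v 0 b).

Lemma vcompM r s (c : 'I_r -> int) (c' : 'I_s -> int) t v (D : 'M[S]_(r, s)) :
    (forall a b, homogz (c a - c' b) (D a b)) ->
  vcomp c' t (v *m D) = vcomp c t v *m D.
Proof.
move=> hD; apply/rowP => b; rewrite !mxE hcomp_sum; apply: eq_bigr => a _.
by rewrite !mxE -(hcompM _ _ (hD a b)) addrA subrK.
Qed.

Lemma submodule_mulmx r (N : 'rV[S]_r -> Prop) m (H : 'M[S]_(m, r)) w :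
  submodule N -> (forall i, N (row i H)) -> N (w *m H).
Proof.
move=> [N0 ND] HN; rewrite mulmx_sum_row; elim/big_ind: _ => //.
  by move=> x y Nx Ny; rewrite -[x]scale1r; apply: ND.
by move=> i _; rewrite -[_ *: _]addr0; apply: ND.
Qed.

(** The homogeneous components of any finite generating family generate as well, and only finitely
    many degrees occur. *)
Lemma graded_submodule_fg r (c : 'I_r -> int) (N : 'rV[S]_r -> Prop) :
    submodule N -> (forall t v, N v -> N (vcomp c t v)) ->
  exists m (c' : 'I_m -> int) (G : 'M[S]_(m, r)),
    (forall a b, homogz (c' a - c b) (G a b)) /\
    forall v, N v <-> exists w, v = w *m G.
Proof.
move=> subN compN; have [m [G GP]] := submodule_fg subN.
pose degs := undup [seq (mdeg x.2)%:Z + c x.1.2 |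
  x <- flatten [seq [seq (ab, l) | l <- msupp (G ab.1 ab.2)]
               | ab <- enum {: 'I_m * 'I_r}]].
have degsP a b l : (G a b)@_l != 0 -> (mdeg l)%:Z + c b \in degs.
  move=> nz; rewrite mem_undup; apply/mapP; exists (a, b, l) => //.
  apply/flattenP; exists [seq ((a, b), l) | l <- msupp (G a b)].
    by apply/mapP; exists (a, b); rewrite ?mem_enum.
  by apply/mapP; exists l; rewrite ?mcoeff_msupp.
pose ts := in_tuple degs; pose T := ('I_m * 'I_(size degs))%type.
pose ct (x : T) := tnth ts x.2.
pose H : 'M[S]_(#|{: T}|, r) :=
  \matrix_x vcomp c (ct (enum_val x)) (row (enum_val x).1 G).
exists #|{: T}|, (fun x => ct (enum_val x)), H; split=> [a b|v].
  by rewrite !mxE; apply: hcomp_homogz.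
split=> [|[w ->]]; last first.
  apply: submodule_mulmx => // i; rewrite rowK; apply: compN; apply/GP.
  by exists (delta_mx 0 (enum_val i).1); rewrite rowE.
case/GP => w ->.
(* [W] adds up the components of each generator over all degrees, so that [W *m H = G]. *)
pose W : 'M[S]_(m, #|{: T}|) := \matrix_(a, x) ((enum_val x).1 == a)%:R.
exists (w *m W); rewrite -mulmxA; congr (_ *m _); apply/matrixP => a b.
pose f (x : T) := (x.1 == a)%:R * hcomp (ct x - c b) (G x.1 b).
have -> : (W *m H) a b = \sum_(x : T) f x.
  rewrite big_enum_val mxE /=; apply: eq_bigr => x _.
  by rewrite !mxE /f.
rewrite -(pair_bigA _ (fun a' k => f (a', k))) /= (bigD1 a) //= [X in _ + X]big1 ?addr0.
  apply/mpolyP => l; rewrite mcoeff_sum.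
  under eq_bigr do rewrite /f /= eqxx mul1r mcoeff_hcomp.
  have [->|nz] := eqVneq (G a b)@_l 0; first by rewrite big1 // => i _; rewrite if_same.
  have /tnthP [i iE] : (mdeg l)%:Z + c b \in ts by apply: (degsP a).
  rewrite (bigD1 i) //= /ct /= -iE addrK eqxx big1 ?addr0 // => j ji.
  case: eqP => // jE; case/eqP: ji; apply/eqP.
  have /tuple_uniqP uts : uniq ts by apply: undup_uniq.
  by apply/eqP/uts; rewrite -iE jE subrK.
by move=> a' a'a; rewrite big1 // => t _; rewrite /f /= (negPf a'a) mul0r.
Qed.

Lemma ker_submodule r s (D : 'M[S]_(r, s)) : submodule (fun v : 'rV_r => v *m D = 0).
Proof.
split=> [|a u v uD vD]; first by rewrite mul0mx.
by rewrite mulmxDl -scalemxAl uD vD scaler0 addr0.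
Qed.

Record graded_map := GradedMap {
  gm_src : nat;
  gm_tgt : nat;
  gm_sdeg : 'I_gm_src -> int;
  gm_tdeg : 'I_gm_tgt -> int;
  gm_mx : 'M[S]_(gm_src, gm_tgt);
  gm_homog : forall a b, homogz (gm_sdeg a - gm_tdeg b) (gm_mx a b)
}.

Lemma ex_syzygy (g : graded_map) :
  exists (m : nat) (c : 'I_m -> int) (D : 'M[S]_(m, gm_src g)),
    (forall a b, homogz (c a - gm_sdeg b) (D a b)) /\
    forall v : 'rV_(gm_src g), v *m gm_mx g = 0 <-> exists w, v = w *m D.
Proof.
apply: graded_submodule_fg; first exact: ker_submodule.
move=> t v v0; rewrite -(vcompM (c' := @gm_tdeg g)) ?v0; last exact: gm_homog.
by apply/rowP => b; rewrite !mxE hcomp0.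
Qed.

Definition next_syzygy (g : graded_map) : graded_map :=
  let m := projT1 (cid (ex_syzygy g)) in
  let c := projT1 (cid (projT2 (cid (ex_syzygy g)))) in
  let D := cid (projT2 (cid (projT2 (cid (ex_syzygy g))))) in
  @GradedMap m (gm_src g) c (@gm_sdeg g) (projT1 D) (projT2 D).1.

(* Retyping the matrix for a variable g keeps the conversion of the index of
   its type local: unfolding iterates of next_syzygy is very expensive. *)
Definition syzygy_mx (g : graded_map) : 'M[S]_(gm_src (next_syzygy g), gm_src g) :=
  gm_mx (next_syzygy g).

Lemma syzygy_mx_homog (g : graded_map) a b :
  homogz (gm_sdeg a - gm_sdeg b) (syzygy_mx g a b).
Proof. exact: (@gm_homog (next_syzygy g) a b). Qed.

Lemma syzygy_mxP (g : graded_map) (v : 'rV_(gm_src g)) :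
  v *m gm_mx g = 0 <-> exists w, v = w *m syzygy_mx g.
Proof. exact: (projT2 (cid (projT2 (cid (projT2 (cid (ex_syzygy g))))))).2. Qed.

Lemma syzygy_mx_exact (g : graded_map) (v : 'rV_(gm_src (next_syzygy g))) :
  v *m syzygy_mx g = 0 <-> exists w, v = w *m syzygy_mx (next_syzygy g).
Proof. exact: (syzygy_mxP (g := next_syzygy g)). Qed.

(** Homogeneous generators of [I], seen as a submodule of the free module of rank 1, start the
    resolution; iterated syzygies continue it. *)
Lemma ex_resolution (I : set S) :
    I 0 -> (forall a u v, I u -> I v -> I (a * u + v)) ->
    (forall d f, I f -> I (hcomp d f)) ->
  exists F, graded_free_resolution F I.
Proof.
move=> I0 ID Ih.
have [||m [c [G [Ghom GP]]]] :=
    @graded_submodule_fg 1 (fun=> 0) (fun v => I (v 0 0)).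
- split=> [|a u v uI vI]; first by rewrite mxE.
  by rewrite !mxE; apply: ID.
- by move=> t v vI; rewrite mxE; apply: Ih.
pose st i := iter i next_syzygy (GradedMap Ghom).
pose F := @FreeSequence K n (fun i => gm_src (st i)) (fun i => @gm_sdeg (st i))
  (fun i => syzygy_mx (st i)) G.
exists F; split.
- by move=> a; have := Ghom a 0; rewrite subr0.
- by move=> i; exact: (@syzygy_mx_homog (st i)).
- move=> f; have := GP f%:M; rewrite mxE eqxx mulr1n => fP.
  by split => [/fP [w E]|[w E]]; [exists w|apply/fP; exists w].
- exact: (@syzygy_mxP (GradedMap Ghom)).
- by move=> i; exact: (@syzygy_mx_exact (st i)).
Qed.

End Graded.

(** * The Koszul complex *)

(** The terms with [i < k] cancel those with [k < i]. The diagonal needs its own hypothesis because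
    of characteristic 2. *)
Lemma sum_antisym (V : zmodType) n (f : 'I_n -> 'I_n -> V) :
    (forall i, f i i = 0) -> (forall i k : 'I_n, (i < k)%N -> f i k = - f k i) ->
  \sum_i \sum_k f i k = 0.
Proof.
move=> fii fik.
have -> : \sum_i \sum_k f i k =
    \sum_(i : 'I_n) \sum_(k : 'I_n | (i < k)%N) f i k +
    \sum_(i : 'I_n) \sum_(k : 'I_n | (k < i)%N) f i k.
  rewrite -big_split /=; apply: eq_bigr => i _.
  rewrite (bigID (fun k : 'I_n => (i < k)%N)) /=; congr (_ + _).
  rewrite (bigD1 i) ?ltnn //= fii add0r; apply: eq_bigl => k.
  by rewrite -leqNgt ltn_neqAle andbC.
rewrite [X in _ + X](exchange_big_dep predT) //= -big_split big1 // => i _.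
by rewrite -big_split big1 // => k ik; rewrite /= (fik _ _ ik) addNr.
Qed.

Section Koszul.
Variables (K : fieldType) (n : nat).
Local Notation S := {mpoly K[n]}.
Implicit Types (t s : {set 'I_n}) (i k l : 'I_n) (m : 'X_{1..n}).

(** Counting the larger elements gives sign 1 to the largest index, the one that the homotopy
    adds. *)
Definition ksgn i t := #|[set k in t | (i < k)%N]|.

Lemma ksgnU i k t : i \notin t -> ksgn k (i |: t) = ((k < i)%N + ksgn k t)%N.
Proof.
move=> it; rewrite /ksgn; case: (ltnP k i) => [ki|ik].
  have -> : [set l in i |: t | (k < l)%N] = i |: [set l in t | (k < l)%N].
    by apply/finset.setP => l; rewrite !inE; case: eqP => [->|]; rewrite ?ki.
  by rewrite cardsU1 inE (negPf it).
apply: eq_card => l; rewrite !inE.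
by case: eqP => [->|//]; rewrite ltnNge ik /= !andbF.
Qed.

(** [y t] is the coefficient of the exterior basis vector [e_t] in the Koszul complex tensored with
    a free module; all Koszul degrees are kept together. *)
Definition chain r := {ffun {set 'I_n} -> 'rV[S]_r}.

Definition kdiff r (y : chain r) : chain r :=
  [ffun t : {set 'I_n} => \sum_(i | i \notin t) ((-1) ^+ ksgn i t * 'X_i) *: y (i |: t)].

Definition cmap r r' (D : 'M[S]_(r, r')) (y : chain r) : chain r' :=
  [ffun t : {set 'I_n} => y t *m D].

Lemma kdiffB r (y z : chain r) : kdiff (y - z) = kdiff y - kdiff z.
Proof.
apply/ffunP => t; rewrite !ffunE -sumrB; apply: eq_bigr => i _.
by rewrite !ffunE scalerBr.
Qed.

Lemma kdiffD r (y z : chain r) : kdiff (y + z) = kdiff y + kdiff z.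
Proof.
apply/ffunP => t; rewrite !ffunE -big_split; apply: eq_bigr => i _.
by rewrite !ffunE scalerDr.
Qed.

Lemma cmapB r r' (D : 'M[S]_(r, r')) (y z : chain r) :
  cmap D (y - z) = cmap D y - cmap D z.
Proof. by apply/ffunP => t; rewrite !ffunE mulmxBl. Qed.

Lemma cmapD r r' (D : 'M[S]_(r, r')) (y z : chain r) :
  cmap D (y + z) = cmap D y + cmap D z.
Proof. by apply/ffunP => t; rewrite !ffunE mulmxDl. Qed.

Lemma cmap0 r r' (D : 'M[S]_(r, r')) : cmap D 0 = 0.
Proof. by apply/ffunP => t; rewrite !ffunE mul0mx. Qed.

Lemma cmap_comp0 r r' r'' (D : 'M[S]_(r, r')) (E : 'M[S]_(r', r'')) y :
  D *m E = 0 -> cmap E (cmap D y) = 0.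
Proof. by move=> DE; apply/ffunP => t; rewrite !ffunE -mulmxA DE mulmx0. Qed.

Lemma kdiff_cmap r r' (D : 'M[S]_(r, r')) (y : chain r) :
  kdiff (cmap D y) = cmap D (kdiff y).
Proof.
apply/ffunP => t; rewrite !ffunE mulmx_suml; apply: eq_bigr => i _.
by rewrite !ffunE scalemxAl.
Qed.

Lemma kdiff_kdiff r (y : chain r) : kdiff (kdiff y) = 0.
Proof.
apply/ffunP => t; rewrite !ffunE big_mkcond /=.
pose f i k : 'rV[S]_r := if [&& i \notin t, k \notin t & k != i] then
  ((-1) ^+ ksgn i t * 'X_i * ((-1) ^+ ksgn k (i |: t) * 'X_k)) *: y (k |: (i |: t))
  else 0.
rewrite (eq_bigr (fun i => \sum_k f i k)) => [|i _]; last first.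
  rewrite /f; case: ifP => it /=; last by rewrite big1.
  rewrite ffunE scaler_sumr big_mkcond /=; apply: eq_bigr => k _.
  by rewrite !inE negb_or andbC scalerA.
apply: sum_antisym => [i|i k ik]; first by rewrite /f eqxx !andbF.
rewrite /f andbCA eq_sym; case: ifP => [/and3P [kt it ki]|_]; last by rewrite oppr0.
rewrite !ksgnU // ik ltnNge (ltnW ik) /= add0n add1n exprS finset.setUCA.
rewrite -scaleNr mulN1r mulNr mulrN opprK; congr (_ *: _).
exact: mulrC.
Qed.

Lemma mcoeff_sign e (p : S) m : ((-1) ^+ e * p)@_m = (-1) ^+ e * p@_m.
Proof.
by rewrite -signr_odd -[in RHS]signr_odd; case: odd; rewrite ?mulN1r ?mcoeffN ?mul1r.
Qed.

Lemma mcoeff_kdiff r (y : chain r) t b m :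
  (kdiff y t 0 b)@_m = \sum_(i | i \notin t) (-1) ^+ ksgn i t *
     (if (U_(i) <= m)%MM then (y (i |: t) 0 b)@_(m - U_(i)) else 0).
Proof.
rewrite ffunE summxE mcoeff_sum; apply: eq_bigr => i _.
by rewrite mxE -mulrA mcoeff_sign mcoeffXM.
Qed.

Lemma mcoeff_kdiff_neq0 r (y : chain r) t b m : (kdiff y t 0 b)@_m != 0 ->
  exists i, [/\ i \notin t, (U_(i) <= m)%MM & (y (i |: t) 0 b)@_(m - U_(i)) != 0].
Proof.
move=> nz; apply: contrapT => no; case/eqP: nz; rewrite mcoeff_kdiff big1 // => i it.
case: ifP => im; last by rewrite mulr0.
have [->|nz] := eqVneq (y (i |: t) 0 b)@_(m - U_(i)) 0; first by rewrite mulr0.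
by case: no; exists i.
Qed.

(* The homotopy contracts the strand of multidegree a, the simplicial chain
   complex of the simplex on the support of a, onto the largest vertex. *)
Definition msup m l := [forall k : 'I_n, (l < k)%N ==> (m k == 0%N)].

Definition ktop t l := (l \in t) && [forall k in t, (k <= l)%N].

Lemma ktop_pred t l : ktop t l -> ktop t =1 pred1 l.
Proof.
move=> /andP [lt /forall_inP lmax] k; apply/idP/eqP => [|->].
  by case/andP=> kt /forall_inP kmax; apply/val_inj/eqP; rewrite eqn_leq lmax //= kmax.
by rewrite /ktop lt; apply/forall_inP.
Qed.

(** Trades a factor [x_l] of the coefficient for the exterior factor [e_l]. [ktop t] holds for at
    most one [l], so the sum has at most one term. *)
Definition khom r (y : chain r) : chain r :=
  [ffun t : {set 'I_n} => \row_b \sum_(l | ktop t l)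
     mslice (msup^~ l) U_(l)%MM (y (t :\ l) 0 b)].

Lemma mcoeff_khom r (y : chain r) t b m l : ktop t l ->
  (khom y t 0 b)@_m = if msup m l then (y (t :\ l) 0 b)@_(m + U_(l)) else 0.
Proof.
move=> tl; rewrite ffunE mxE mcoeff_sum (eq_bigl _ _ (ktop_pred tl)).
by rewrite big_pred1_eq mcoeff_mslice.
Qed.

Lemma mcoeff_khom_neq0 r (y : chain r) t b m :
  (khom y t 0 b)@_m != 0 -> exists l,
    [/\ ktop t l, msup m l & (y (t :\ l) 0 b)@_(m + U_(l)) != 0].
Proof.
case: (pickP (ktop t)) => [l tl|no].
  by rewrite (mcoeff_khom _ _ _ tl); case: ifP => [ml|_]; [exists l|rewrite eqxx].
by rewrite ffunE mxE mcoeff_sum big_pred0 // eqxx.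
Qed.

(** Coefficients are compared at [x^m e_t], with [l] the largest index of the multidegree. The
    second hypothesis covers multidegree 0, where the homotopy gives nothing. *)
Lemma kdiff_khom r (y : chain r) : kdiff y = 0 ->
  (forall b, (y finset.set0 0 b)@_0 = 0) -> kdiff (khom y) = y.
Proof.
move=> yz y0; apply/ffunP => t; apply/rowP => b; apply/mpolyP => m.
pose Sup := [set k in t] :|: [set k | m k != 0%N].
have [Sup0|[l0 l0S]] := finset.set_0Vmem Sup.
  have t0 : t = finset.set0.
    by apply/finset.setP => k; have /finset.setP /(_ k) := Sup0; rewrite !inE => /norP [/negPf -> _].
  have m0 : m = 0%MM.
    apply/mnmP => k; have /finset.setP /(_ k) := Sup0; rewrite !inE mnm0E.
    by move/negbT => /norP [_ /negPn /eqP].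
  rewrite t0 m0 y0 mcoeff_kdiff big1 // => i _; rewrite lep1mP mnm0E eqxx /=.
  by rewrite mulr0.
pose l := [arg max_(k > l0 in Sup) k].
have [lS lmax] : l \in Sup /\ forall k, k \in Sup -> (k <= l)%N.
  by rewrite /l; case: arg_maxnP.
have ml : msup m l.
  apply/forall_inP => k lk; apply: contraTT lk => mk; rewrite -leqNgt lmax //.
  by rewrite !inE mk orbT.
have tle k : k \in t -> (k <= l)%N by move=> kt; apply: lmax; rewrite !inE kt.
have mle k : m k != 0%N -> (k <= l)%N by move=> kt; apply: lmax; rewrite !inE kt orbT.
(* If [l] is not in [t], only [i = l] contributes, returning the coefficient of [y]: for other [i]
   the monomial keeps [x_l], while no index of [i |: t] reaches [l]. *)
have [lt|lt] := boolP (l \in t); last first.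
  have mll : (U_(l) <= m)%MM by rewrite lep1mP; move: lS; rewrite !inE (negPf lt).
  have lt_l k : k \in t -> (k < l)%N.
    move=> kt; rewrite ltn_neqAle tle // andbT; apply: contraNneq lt => E.
    by rewrite -(val_inj E).
  have tl : ktop (l |: t) l.
    rewrite /ktop !inE eqxx /=; apply/forall_inP => k; rewrite !inE.
    by case/predU1P => [->//|/tle].
  rewrite mcoeff_kdiff (bigD1 l) //= mll (mcoeff_khom _ _ _ tl) submK // finset.setU1K //.
  have -> : msup (m - U_(l))%MM l.
    apply/forall_inP => k lk; rewrite mnmBE.
    by move/forall_inP: ml => /(_ k lk) /eqP ->.
  have -> : ksgn l t = 0%N.
    apply: eq_card0 => k; rewrite !inE; apply/negP => /andP [/tle].
    by rewrite leqNgt => /negbTE ->.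
  rewrite mul1r big1 ?addr0 // => i /andP [it il].
  case: ifP => mi; last by rewrite mulr0.
  apply/eqP; apply: contraT; rewrite mulf_eq0 negb_or => /andP [_ /mcoeff_khom_neq0].
  case=> k [/andP [kt _] mk _]; move/forall_inP: mk => /(_ l).
  rewrite mnmBE mnm1E (negPf il) subn0; move: mll; rewrite lep1mP => /negPf ->.
  apply; move: kt; rewrite !inE => /predU1P [->|/lt_l //].
  rewrite ltn_neqAle mle ?andbT; first by apply: contraNneq il => /val_inj ->.
  by rewrite -lep1mP.
(* If [l] is in [t], the cycle condition at [t :\ l] and [x_l x^m] expresses the coefficient by the
   other terms, which are those of [kdiff (khom y)]; removing [l] from [t] changes [ksgn i] by
   one. *)
have := congr1 (fun z : chain r => (z (t :\ l) 0 b)@_(m + U_(l))) yz.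
rewrite [RHS](_ : _ = 0); last by rewrite ffunE mxE mcoeff0.
rewrite mcoeff_kdiff (bigD1 l) ?inE ?eqxx //= finset.setD1K // lem_addl addmK.
have -> : ksgn l (t :\ l) = 0%N.
  apply: eq_card0 => k; rewrite !inE; apply/negP => /andP [/andP [_ /tle]].
  by rewrite leqNgt => /negbTE ->.
rewrite mul1r => /eqP; rewrite addr_eq0 => /eqP ->.
rewrite mcoeff_kdiff -sumrN; apply: eq_big => [i|i it].
  by rewrite !inE; case: eqP => [->|_]; rewrite ?lt ?andbF // andbT.
have il : i != l by apply: contraNneq it => ->.
have tl : ktop (i |: t) l || (l < i)%N.
  rewrite /ktop !inE lt orbT /=.
  case: (leqP i l) => il'; last by rewrite orbT.
  by rewrite orbF; apply/forall_inP => k; rewrite !inE => /predU1P [->|/tle].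
have -> : (U_(i) <= m + U_(l))%MM = (U_(i) <= m)%MM.
  by rewrite !lep1mP mnmDE mnm1E [l == i]eq_sym (negPf il) addn0.
case: ifP => mi; last by rewrite !mulr0 oppr0.
have {tl} tl : ktop (i |: t) l.
  by move: mi tl; rewrite lep1mP => /mle; rewrite leqNgt => /negPf ->; rewrite orbF.
have -> : (m + U_(l) - U_(i) = m - U_(i) + U_(l))%MM.
  by rewrite [RHS]addmC addmBA // addmC.
rewrite (mcoeff_khom _ _ _ tl).
have -> : msup (m - U_(i))%MM l.
  apply/forall_inP => k lk; rewrite mnmBE.
  by move/forall_inP: ml => /(_ k lk) /eqP ->.
have -> : (i |: t) :\ l = i |: t :\ l.
  by apply/finset.setP => k; rewrite !inE; case: eqP => [->|//]; rewrite eq_sym (negPf il).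
rewrite -{1}(finset.setD1K lt) ksgnU ?inE ?eqxx //.
have -> : (i < l)%N by rewrite ltn_neqAle (inj_eq val_inj) il mle // -lep1mP.
by rewrite add1n exprS mulN1r mulNr.
Qed.

End Koszul.

(** * Koszul homology and Betti numbers *)

Section GradedChains.
Variables (K : fieldType) (n : nat) (j : int).
Local Notation S := {mpoly K[n]}.
Implicit Types (p q : nat).

(* The degree j part of K_p(x) (x) F, where c gives the degrees of a basis of F. *)
Definition gchain p r (c : 'I_r -> int) (y : chain K n r) : Prop :=
  forall t b m, (y t 0 b)@_m != 0 -> #|t| = p /\ (mdeg m)%:Z + p%:Z + c b = j.

Definition cproj p r (c : 'I_r -> int) (y : chain K n r) : chain K n r :=
  [ffun t : {set 'I_n} => if #|t| == p then vcomp c (j - p%:Z) (y t) else 0].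

Lemma gchain_cproj p r (c : 'I_r -> int) (y : chain K n r) : gchain p c (cproj p c y).
Proof.
move=> t b m; rewrite ffunE; case: ifPn => [/eqP tp|_]; last by rewrite mxE mcoeff0 eqxx.
rewrite mxE mcoeff_hcomp; case: ifPn => [/eqP E _|_]; last by rewrite eqxx.
by split=> //; rewrite E; lia.
Qed.

Lemma cproj_id p r (c : 'I_r -> int) (y : chain K n r) : gchain p c y -> cproj p c y = y.
Proof.
move=> yP; apply/ffunP => t; apply/rowP => b; apply/mpolyP => m; rewrite ffunE.
have [y0|nz] := eqVneq (y t 0 b)@_m 0.
  by rewrite y0; case: ifP => _; rewrite mxE ?mcoeff_hcomp ?y0 ?if_same ?mcoeff0.
have [tp E] := yP _ _ _ nz; rewrite tp eqxx mxE mcoeff_hcomp ifT //; lia.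
Qed.

Lemma cproj_cmap p r r' (c : 'I_r -> int) (c' : 'I_r' -> int) (D : 'M[S]_(r, r')) y :
    (forall a b, homogz (c a - c' b) (D a b)) ->
  cproj p c' (cmap D y) = cmap D (cproj p c y).
Proof.
move=> Dh; apply/ffunP => t; rewrite !ffunE; case: ifP => _; last by rewrite mul0mx.
exact: vcompM.
Qed.

Lemma gchain_cmap p r r' (c : 'I_r -> int) (c' : 'I_r' -> int) (D : 'M[S]_(r, r')) y :
    (forall a b, homogz (c a - c' b) (D a b)) ->
  gchain p c y -> gchain p c' (cmap D y).
Proof.
by move=> Dh /cproj_id <-; rewrite -(cproj_cmap _ _ Dh); apply: gchain_cproj.
Qed.

Lemma gchainB p r (c : 'I_r -> int) (y z : chain K n r) :
  gchain p c y -> gchain p c z -> gchain p c (y - z).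
Proof.
move=> yP zP t b m; rewrite !ffunE !mxE mcoeffB.
have [->|nz _] := eqVneq (y t 0 b)@_m 0; last exact: (yP _ _ _ nz).
by rewrite sub0r oppr_eq0; apply: zP.
Qed.

Lemma gchain_kdiff p r (c : 'I_r -> int) (y : chain K n r) :
  gchain p.+1 c y -> gchain p c (kdiff y).
Proof.
move=> yP t b m /mcoeff_kdiff_neq0 [i [it im /yP [tp E]]].
move: tp; rewrite cardsU1 it => -[tp]; split=> //.
by rewrite -E -[in LHS](submK im) mdegD mdeg1; lia.
Qed.

Lemma gchain_khom p r (c : 'I_r -> int) (y : chain K n r) :
  gchain p c y -> gchain p.+1 c (khom y).
Proof.
move=> yP t b m /mcoeff_khom_neq0 [l [/andP [lt _] ml /yP [tp E]]].
by move: (cardsD1 l t); rewrite lt tp mdegD mdeg1 in E * => ->; split=> //; lia.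
Qed.

Lemma gchain_const p r (c : 'I_r -> int) (y : chain K n r) b :
  gchain p.+1 c y -> (y finset.set0 0 b)@_0 = 0.
Proof.
by move=> yP; apply/eqP; apply: contraT => /yP []; rewrite cards0.
Qed.

Lemma kdiff_const r (y : chain K n r) b : (kdiff y finset.set0 0 b)@_0 = 0.
Proof.
rewrite mcoeff_kdiff big1 // => i _.
by rewrite lep1mP mnm0E eqxx mulr0.
Qed.

Lemma kdiff_gchain0 r (c : 'I_r -> int) (y : chain K n r) : gchain 0 c y -> kdiff y = 0.
Proof.
move=> yP; apply/ffunP => t; apply/rowP => b; apply/mpolyP => m.
rewrite [RHS](_ : _ = 0); last by rewrite ffunE mxE mcoeff0.
apply/eqP; apply: contraT => /mcoeff_kdiff_neq0 [i [it _ /yP []]].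
by rewrite cardsU1 it.
Qed.

(** Preimages chosen for each [t] separately need not be homogeneous; [cproj] makes them so and
    commutes with [D]. *)
Lemma gchain_lift p r r' (c : 'I_r -> int) (c' : 'I_r' -> int) (D : 'M[S]_(r, r')) z :
    (forall a b, homogz (c a - c' b) (D a b)) -> gchain p c' z ->
    (forall t, exists w, z t = w *m D) ->
  exists2 y, gchain p c y & z = cmap D y.
Proof.
move=> Dh zP zD; pose y : chain K n r := [ffun t => projT1 (cid (zD t))].
exists (cproj p c y); first exact: gchain_cproj.
rewrite -(cproj_cmap _ _ Dh) -[LHS](cproj_id zP); congr cproj.
by apply/ffunP => t; rewrite !ffunE; case: (cid _).
Qed.

Lemma koszul_exact p r (c : 'I_r -> int) (y : chain K n r) :
    gchain p c y -> kdiff y = 0 -> (forall b, (y finset.set0 0 b)@_0 = 0) ->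
  exists2 u, gchain p.+1 c u & y = kdiff u.
Proof.
by move=> yP yz y0; exists (khom y); [apply: gchain_khom|rewrite kdiff_khom].
Qed.

End GradedChains.

(** * Comparison of a resolution with the Koszul complex *)

Section Balancing.
Variables (K : fieldType) (n : nat) (I : set {mpoly K[n]}) (F : free_sequence K n).
Hypothesis resF : graded_free_resolution F I.
Variable j : int.
Local Notation S := {mpoly K[n]}.
Implicit Types (p q : nat).

(* The resolution, augmented by S in position 0. *)
Definition arank q := if q is q'.+1 then frank F q' else 1%N.

Definition adeg q : 'I_(arank q) -> int :=
  match q with 0 => fun=> 0 | q'.+1 => @fdeg _ _ F q' end.

Definition adiff q : 'M[S]_(arank q.+1, arank q) :=
  match q with 0 => faug F | q'.+1 => fdiff F q' end.

Lemma adiff_homog q a b : homogz (adeg a - adeg b) (adiff q a b).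
Proof.
have [hA hD _ _ _] := resF; case: q a b => [|q] a b /=; last exact: hD.
by rewrite subr0 ord1.
Qed.

Lemma adiff_exact q (v : 'rV_(arank q.+1)) :
  v *m adiff q = 0 <-> exists w, v = w *m adiff q.+1.
Proof. by have [_ _ _ eA eD] := resF; case: q v => [|q] v /=; [exact: eA|exact: eD]. Qed.

Lemma adiffM q : adiff q.+1 *m adiff q = 0.
Proof.
apply/row_matrixP => i; rewrite row_mul row0; apply/adiff_exact.
by exists (delta_mx 0 i); rewrite rowE.
Qed.

Lemma cmap_exact p q (y : chain K n (arank q.+1)) : gchain j p (@adeg q.+1) y ->
  cmap (adiff q) y = 0 -> exists2 w, gchain j p (@adeg q.+2) w & y = cmap (adiff q.+1) w.
Proof.
move=> yP yD; apply: (gchain_lift (@adiff_homog q.+1) yP) => t.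
by apply/adiff_exact; have /ffunP /(_ t) := yD; rewrite !ffunE.
Qed.

(* In a position q > 0 the Koszul complex is augmented by F_(q-1) (x) K; in
   position 0, where it is that of I, it is not. *)
Definition acycle q (z : chain K n (arank q)) : Prop :=
  kdiff z = 0 /\ ((0 < q)%N -> forall b, (z finset.set0 0 b)@_0 = 0).

(* Exactness of the total complex at (p, q + 1), up to the augmentations. *)
Definition splits_at p q : Prop := forall y : chain K n (arank q.+1),
  gchain j p (@adeg q.+1) y -> acycle (cmap (adiff q) y) ->
  exists u w, [/\ gchain j p.+1 (@adeg q.+1) u, gchain j p (@adeg q.+2) w &
    y = kdiff u + cmap (adiff q.+1) w].

(** Write D for the maps of the resolution. With [kdiff y = D y'] and [y' = kdiff u + D w], the
    chain [y - D u] is a Koszul cycle in positive Koszul degree, hence a boundary. *)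
Lemma splits_at_zig p q : splits_at p q.+1 -> splits_at p.+1 q.
Proof.
move=> H y yP [yz _].
have [y' y'P yy'] : exists2 y', gchain j p (@adeg q.+2) y' & kdiff y = cmap (adiff q.+1) y'.
  by apply: cmap_exact; [exact: gchain_kdiff|rewrite -kdiff_cmap].
have [u [w [uP wP y'E]]] : exists u w, [/\ gchain j p.+1 (@adeg q.+2) u,
    gchain j p (@adeg q.+3) w & y' = kdiff u + cmap (adiff q.+2) w].
  apply: H => //; rewrite -yy'; split=> [|_ b]; first exact: kdiff_kdiff.
  exact: kdiff_const.
have DuP : gchain j p.+1 (@adeg q.+1) (cmap (adiff q.+1) u).
  by apply: gchain_cmap uP; apply: adiff_homog.
have zP := gchainB yP DuP.
have [||v vP vE] := koszul_exact zP.
- by rewrite kdiffB yy' y'E cmapD cmap_comp0 ?adiffM // addr0 kdiff_cmap subrr.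
- by move=> b; apply: gchain_const zP.
by exists v, u; split => //; rewrite -vE subrK.
Qed.

(** The mirror image: with [D y = kdiff y'] and [y' = kdiff u + D w], the chain [y - kdiff w] is
    killed by D, hence in the image of D. *)
Lemma splits_at_zag p q : splits_at p.+1 q -> splits_at p q.+1.
Proof.
move=> H y yP [yz y0].
have DyP : gchain j p (@adeg q.+1) (cmap (adiff q.+1) y).
  by apply: gchain_cmap yP; apply: adiff_homog.
have [y' y'P yy'] := koszul_exact DyP yz (y0 isT).
have Dy'P : gchain j p.+1 (@adeg q) (cmap (adiff q) y').
  by apply: gchain_cmap y'P; apply: adiff_homog.
have [|u [w [uP wP y'E]]] := H y' y'P.
  split=> [|_ b]; last exact: gchain_const Dy'P.
  by rewrite kdiff_cmap -yy' cmap_comp0 ?adiffM.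
have [|v vP vE] := cmap_exact (gchainB yP (gchain_kdiff wP)).
  rewrite cmapB yy' y'E -kdiff_cmap.
  have -> : kdiff (kdiff u + cmap (adiff q.+1) w) = kdiff (cmap (adiff q.+1) w).
    by rewrite kdiffD kdiff_kdiff add0r.
  by rewrite subrr.
by exists w, v; split => //; rewrite -vE addrC subrK.
Qed.

Lemma splits_at_diag p : splits_at p 0 <-> splits_at 0 p.
Proof.
suff H q : splits_at p q <-> splits_at 0 (p + q) by rewrite -[p in splits_at 0 p]addn0.
elim: p q => [//|p IH] q; rewrite addSnnS -IH.
by split; [exact: splits_at_zag|exact: splits_at_zig].
Qed.


(** This is the vanishing of Tor_p(I, K) in degree [j], computed from the Koszul resolution of K. *)
Definition koszul_vanish p : Prop := forall z : chain K n 1,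
  gchain j p (fun=> 0) z -> (forall t, I (z t 0 0)) -> kdiff z = 0 ->
  exists w, [/\ gchain j p.+1 (fun=> 0) w, forall t, I (w t 0 0) & z = kdiff w].

Lemma mem_aug (v : 'rV[S]_1) : I (v 0 0) <-> exists w, v = w *m faug F.
Proof.
have [_ _ IP _ _] := resF; split=> [/IP [w E]|[w ->]].
  by exists w; rewrite E; apply: mx11_scalar.
by apply/IP; exists w; apply: mx11_scalar.
Qed.

(** Chains with coefficients in [I] are the images of chains over F_0, and the kernel of this map is
    the image of the chains over F_1. *)
Lemma splits_at_koszul p : splits_at p 0 <-> koszul_vanish p.
Proof.
split=> [H z zP zI zz|H y yP [yz _]].
  have [|y yP zE] := gchain_lift (@adiff_homog 0) zP (z := z).
    by move=> t; apply/mem_aug.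
  have [|u [w [uP wP yE]]] := H y yP; first by rewrite -zE.
  exists (cmap (faug F) u); split.
  - by apply: gchain_cmap uP; apply: (@adiff_homog 0).
  - by move=> t; rewrite ffunE; apply/mem_aug; exists (u t).
  - by rewrite zE yE cmapD cmap_comp0 ?(@adiffM 0) // addr0 kdiff_cmap.
have [|w [wP wI wE]] := H _ (gchain_cmap (@adiff_homog 0) yP) _ yz.
  by move=> t; rewrite ffunE; apply/mem_aug; exists (y t).
have [|y' y'P y'E] := gchain_lift (@adiff_homog 0) wP (z := w).
  by move=> t; apply/mem_aug.
have [|v vP vE] := cmap_exact (gchainB yP (gchain_kdiff y'P)).
  by rewrite cmapB wE y'E kdiff_cmap subrr.
by exists y', v; split => //; rewrite -vE addrC subrK.
Qed.

Definition cst r (v : 'rV[S]_r) : 'rV[K]_r := map_mx (mcoeff 0%MM) v.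

Lemma cstM r r' (v : 'rV[S]_r) (D : 'M[S]_(r, r')) :
  cst (v *m D) = cst v *m map_mx (mcoeff 0%MM) D.
Proof. exact: map_mxM. Qed.

Definition cst_lift r (x : 'rV[K]_r) : 'rV[S]_r := map_mx (@mpolyC n K) x.

Lemma cst_liftK r (x : 'rV[K]_r) : cst (cst_lift x) = x.
Proof. by apply/rowP => b; rewrite !mxE mpolyCK. Qed.

Lemma tensor_degP q (x : 'rV[K]_(frank F q)) :
  (x <= tensor_deg F q j)%MS <-> forall a, x 0 a != 0 -> fdeg a = j.
Proof.
have mulE (w : 'rV[K]_(frank F q)) a :
    (w *m tensor_deg F q j) 0 a = w 0 a * (fdeg a == j)%:R.
  rewrite mxE (bigD1 a) //= big1 ?addr0 => [|b ba]; last first.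
    by rewrite !mxE (negPf ba) mulr0n mulr0.
  by rewrite !mxE eqxx mulr1n.
split=> [/submxP [w ->] a|H].
  by rewrite mulE; case: (fdeg a =P j) => // _; rewrite mulr0 eqxx.
apply/submxP; exists x; apply/rowP => a; rewrite mulE.
by have [->|/H ->] := eqVneq (x 0 a) 0; rewrite ?mul0r // eqxx mulr1.
Qed.

Lemma tensor_cyclesP q (x : 'rV[K]_(frank F q)) :
  (x <= tensor_cycles F q j)%MS <-> (x <= tensor_deg F q j)%MS /\
    ((0 < q)%N -> forall b, ((cst_lift x *m adiff q) 0 b)@_0 = 0).
Proof.
case: q x => [|q] x /=; first by split=> [->|[]].
have xE : x *m tensor_diff F q = cst (cst_lift x *m fdiff F q) by rewrite cstM cst_liftK.
rewrite sub_capmx (sameP sub_kermxP eqP) xE; split=> [/andP [-> /eqP x0]|[-> x0]].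
  by split=> // _ b; have /rowP /(_ b) := x0; rewrite mxE [RHS]mxE.
by apply/eqP/rowP => b; rewrite mxE [RHS]mxE x0.
Qed.

Lemma tensor_diff_homog q a b : tensor_diff F q a b != 0 -> fdeg a = fdeg b.
Proof.
have [_ hD _ _ _] := resF.
rewrite mxE => nz; have /homogzP /(_ _ nz) := hD q a b.
by rewrite mdeg0 => /eqP; rewrite eq_sym subr_eq0 => /eqP.
Qed.

Lemma tensor_boundaries_cycles q :
  (tensor_boundaries F q j <= tensor_cycles F q j)%MS.
Proof.
have degB : (tensor_boundaries F q j <= tensor_deg F q j)%MS.
  apply/row_subP => a; apply/tensor_degP => b.
  rewrite /tensor_boundaries /tensor_deg mul_diag_mx !mxE.
  case: (fdeg a =P j) => [<-|_]; last by rewrite mul0r eqxx.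
  by rewrite mul1r => nz; rewrite (@tensor_diff_homog q a b) // mxE.
case: q degB => [//|q] degB /=; rewrite sub_capmx degB /=.
apply/sub_kermxP; rewrite /tensor_boundaries -mulmxA.
by rewrite /tensor_diff -map_mxM (adiffM q.+1) map_mx0 mulmx0.
Qed.

Lemma tor_dim_eq0 q :
  tor_dim F q j = 0%N <-> (tensor_cycles F q j <= tensor_boundaries F q j)%MS.
Proof.
rewrite -(geq_leqif (mxrank_leqif_sup (tensor_boundaries_cycles q))) -subn_eq0.
by split=> /eqP.
Qed.

Definition chain0 r (v : 'rV[S]_r) : chain K n r :=
  [ffun t : {set 'I_n} => if t == finset.set0 then v else 0].

Lemma gchain_chain0 q (v : 'rV[S]_(arank q.+1)) :
  (forall a m, (v 0 a)@_m != 0 -> (mdeg m)%:Z + adeg a = j) ->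
  gchain j 0 (@adeg q.+1) (chain0 v).
Proof.
move=> vj t b m; rewrite ffunE; case: (t =P finset.set0) => [->|_];
  last by rewrite mxE mcoeff0 eqxx.
by move/vj; rewrite cards0 addr0.
Qed.

Lemma cst_lift_deg q (x : 'rV[K]_(frank F q)) : (x <= tensor_deg F q j)%MS ->
  forall a m, ((cst_lift x) 0 a)@_m != 0 -> (mdeg m)%:Z + fdeg a = j.
Proof.
move=> /tensor_degP xj a m; rewrite mxE mcoeffC.
case: (m =P 0%MM) => [->|_]; last by rewrite mulr0 eqxx.
by rewrite mulr1 mdeg0 add0r; apply: xj.
Qed.

Lemma gchain0_deg q (y : chain K n (frank F q)) : gchain j 0 (@fdeg _ _ F q) y ->
  (cst (y finset.set0) <= tensor_deg F q j)%MS.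
Proof.
move=> yP; apply/tensor_degP => a; rewrite mxE => /yP [_].
by rewrite mdeg0 !add0r.
Qed.

(** In Koszul degree 0 the boundaries are the chains without constant term, so a splitting of [y]
    says that [y] modulo the variables is a boundary of F tensored with K. *)
Lemma splits_at_tor q : splits_at 0 q <-> tor_dim F q j = 0%N.
Proof.
rewrite tor_dim_eq0; split=> [H|sZB y yP [_ y0]].
  apply/row_subP => i; set x := row i _.
  have /tensor_cyclesP [xj x0] : (x <= tensor_cycles F q j)%MS by apply: row_sub.
  have vP : gchain j 0 (@adeg q.+1) (chain0 (cst_lift x)).
    by apply: gchain_chain0; apply: cst_lift_deg.
  have [|u [w [uP wP E]]] := H _ vP.
    rewrite /acycle kdiff_cmap (kdiff_gchain0 vP) cmap0; split=> // q0 b.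
    by rewrite !ffunE eqxx; apply: x0.
  have -> : x = cst (w finset.set0) *m tensor_diff F q.
    rewrite -[x]cst_liftK -cstM; apply/rowP => b; rewrite mxE [RHS]mxE.
    have /ffunP /(_ finset.set0) /rowP /(_ b) := E; rewrite ffunE eqxx => ->.
    by rewrite ffunE mxE mcoeffD kdiff_const add0r ffunE.
  exact/submxMr/(gchain0_deg wP).
have xj := gchain0_deg yP; set x := cst _ in xj.
have : (x <= tensor_cycles F q j)%MS.
  apply/tensor_cyclesP; split=> // q0 b; have := y0 q0 b; rewrite ffunE.
  have E (v v' : 'rV[S]_(frank F q)) : cst v = cst v' ->
      ((v *m adiff q) 0 b)@_0 = ((v' *m adiff q) 0 b)@_0.
    move=> vv'; have /rowP /(_ b) : cst (v *m adiff q) = cst (v' *m adiff q).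
      by rewrite !cstM vv'.
    by rewrite mxE [RHS]mxE.
  by rewrite (E _ (cst_lift x)) // cst_liftK.
move=> /submx_trans /(_ sZB) /submxP [s xE].
(* A preimage over K is lifted by constants; then the difference of [y] and the image of [w] has no
   constant term and is a Koszul boundary. *)
pose w := chain0 (cst_lift (s *m tensor_deg F q.+1 j)).
have wP : gchain j 0 (@adeg q.+2) w.
  by apply: gchain_chain0; apply: cst_lift_deg; apply: submxMl.
have DwP := gchain_cmap (@adiff_homog q.+1) wP.
have zP := gchainB yP DwP.
have [||u uP uE] := koszul_exact zP.
- exact: kdiff_gchain0 zP.
- move=> b; rewrite !ffunE eqxx.
  set v := _ *m adiff _; have vE : cst v = x by rewrite cstM cst_liftK xE mulmxA.
  have /rowP /(_ b) : cst (y finset.set0 - v) = 0 by rewrite /cst map_mxB -!/(cst _) vE subrr.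
  by rewrite mxE [RHS]mxE.
by exists u, w; split => //; rewrite -uE subrK.
Qed.

Lemma tor_dim_koszul p : tor_dim F p j = 0%N <-> koszul_vanish p.
Proof. by rewrite -splits_at_koszul splits_at_diag splits_at_tor. Qed.

End Balancing.

(** * Powers of sets of monomials *)

Section MonomialSets.
Variable n : nat.
Local Notation mon := 'X_{1..n}.
Implicit Types (U V : mon -> Prop) (m u v : mon) (d k : nat) (s : seq mon).

Definition upclosed U := forall m m', U m -> (m <= m')%MM -> U m'.

(* For U the set of monomials of I this says that (I_l : x_l) / I_l vanishes in
   degrees >= d, where I_l is the image of I in S / (x_(l+1), ..., x_n). *)
Definition satbound U d := forall u l,
  msup u l -> U (u + U_(l))%MM -> (d <= mdeg u)%N -> U u.

Definition msum s : mon := (\sum_(x <- s) x)%MM.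

Lemma msum_cons x s : msum (x :: s) = (x + msum s)%MM.
Proof. by rewrite /msum big_cons. Qed.

(** For [U] the monomials of [I] these are the monomials of [I^k]. Allowing multiples of the product
    keeps the set closed under multiples even if [U] is not, as for the elements of degree exactly
    [d] below. *)
Definition mpow U k m := exists s,
  [/\ size s = k, forall x, x \in s -> U x & (msum s <= m)%MM].

Lemma mpow_sub U V k m : (forall x, U x -> V x) -> mpow U k m -> mpow V k m.
Proof. by move=> UV [s [sk sU sm]]; exists s; split => // x /sU /UV. Qed.

Lemma mpow_upclosed U k : upclosed (mpow U k).
Proof. by move=> m m' [s [sk sU sm]] mm'; exists s; split => //; apply: lepm_trans mm'. Qed.

Lemma mpowS U k m v : U v -> (v <= m)%MM -> mpow U k (m - v)%MM -> mpow U k.+1 m.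
Proof.
move=> Uv vm [s [sk sU sm]]; exists (v :: s); split; first by rewrite /= sk.
  by move=> x; rewrite inE => /predU1P [->|/sU].
rewrite msum_cons; apply/mnm_lepP => i; move/mnm_lepP: vm => /(_ i).
by move/mnm_lepP: sm => /(_ i); rewrite mnmDE mnmBE; lia.
Qed.

Lemma neq0_supp m : m != 0%MM -> exists i, m i != 0%N.
Proof.
move=> m0; apply/existsP; apply: contraNT m0; rewrite negb_exists => /forallP H.
by apply/eqP/mnmP => i; rewrite mnm0E; apply/eqP; have := H i; rewrite negbK.
Qed.

Lemma ex_msup m : m != 0%MM -> exists2 l, m l != 0%N & msup m l.
Proof.
case/neq0_supp => i0 i0m.
case: (@arg_maxnP _ i0 (fun i => m i != 0%N) (fun i => val i) i0m) => l lm lmax.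
exists l => //; apply/forall_inP => k lk; apply: contraTT lk => km.
by rewrite -leqNgt; apply: lmax.
Qed.

Lemma msup_le u v l : (u <= v)%MM -> msup v l -> msup u l.
Proof.
move=> /mnm_lepP uv /forall_inP vl; apply/forall_inP => k /vl /eqP E.
by have := uv k; rewrite E leqn0.
Qed.

Lemma msupDU u (l k : 'I_n) : (k <= l)%N -> msup u l -> msup (u + U_(k))%MM l.
Proof.
move=> kl /forall_inP ul; apply/forall_inP => i li; rewrite mnmDE mnm1E.
by rewrite (eqP (ul i li)); case: (k =P i) => [E|//]; move: li; rewrite -E ltnNge kl.
Qed.

Lemma ex_submnm m d : (d <= mdeg m)%N -> exists2 m', (m' <= m)%MM & mdeg m' = d.
Proof.
elim: d => [_|d IH dm].
  by exists 0%MM; rewrite ?mdeg0 //; apply/mnm_lepP => i; rewrite mnm0E.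
have [m' m'm m'd] := IH (ltnW dm).
have [|i] := @neq0_supp (m - m')%MM.
  by rewrite -mdeg_eq0; have := congr1 mdeg (submK m'm); rewrite mdegD m'd; lia.
rewrite mnmBE => im; exists (m' + U_(i))%MM; last by rewrite mdegD mdeg1 m'd addn1.
apply/mnm_lepP => k; rewrite mnmDE mnm1E; move/mnm_lepP: m'm => /(_ k).
by case: eqP => [<-|_] /=; lia.
Qed.

Section Satbound.
Variables (U : mon -> Prop) (d : nat).
Hypotheses (Uup : upclosed U) (Ud : satbound U d).

(** While the degree exceeds [d], the condition allows division by the largest variable of [v]. *)
Lemma satbound_shrink v : U v ->
  exists v', [/\ (v' <= v)%MM, U v' & (mdeg v' <= d)%N].
Proof.
elim: {v}(mdeg v) {-2}v (leqnn (mdeg v)) => [|c IH] v vc Uv.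
  by exists v; split; rewrite ?lepm_refl //; lia.
have [vd|dv] := leqP (mdeg v) d; first by exists v; split; rewrite ?lepm_refl.
have [|l lv vl] := @ex_msup v; first by rewrite -mdeg_eq0; lia.
have lev : (U_(l) <= v)%MM by rewrite lep1mP.
have mv : mdeg (v - U_(l))%MM = (mdeg v).-1.
  by rewrite -{2}(submK lev) mdegD mdeg1 addn1.
have [||v' [v'v Uv' v'd]] := IH (v - U_(l))%MM; first by rewrite mv; lia.
  apply: (Ud (l := l)); rewrite ?submK ?mv //; first by apply: msup_le vl; apply: lem_subr.
  by lia.
by exists v'; split => //; apply: lepm_trans v'v _; apply: lem_subr.
Qed.

Lemma mdeg_msum_le s :
  (forall x, x \in s -> (mdeg x <= d)%N) -> (mdeg (msum s) <= size s * d)%N.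
Proof.
elim: s => [|x s IH] H; first by rewrite /msum big_nil mdeg0.
rewrite msum_cons mdegD /= mulSn leq_add ?H ?mem_head // IH // => y ys.
by apply: H; rewrite inE ys orbT.
Qed.

(** The cofactor of the product in [m] has enough degree to raise each factor to degree exactly
    [d]. *)
Lemma mpow_fill s m :
    (forall x, x \in s -> U x /\ (mdeg x <= d)%N) -> (msum s <= m)%MM ->
    (size s * d <= mdeg m)%N ->
  mpow (fun x => U x /\ mdeg x = d) (size s) m.
Proof.
elim: s m => [|v s IH] m sU sm ms; first by exists [::].
have [Uv vd] := sU v (mem_head _ _).
have sU' x : x \in s -> U x /\ (mdeg x <= d)%N by move=> xs; apply: sU; rewrite inE xs orbT.
have sd : (mdeg (msum s) <= size s * d)%N.
  by apply: mdeg_msum_le => x /sU' [].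
have mE := congr1 mdeg (submK sm); rewrite mdegD msum_cons mdegD in mE.
rewrite /= mulSn in ms.
have [|t tm td] := @ex_submnm (m - (v + msum s))%MM (d - mdeg v)%N; first by lia.
rewrite msum_cons in sm; move/mnm_lepP: sm => sm; move/mnm_lepP: tm => tm.
have vtm : (v + t <= m)%MM.
  by apply/mnm_lepP => i; have := sm i; have := tm i; rewrite mnmBE !mnmDE; lia.
apply: (@mpowS _ _ _ (v + t)%MM) => //.
  split; last by rewrite mdegD td; lia.
  by apply: Uup Uv _; apply: lem_addr.
apply: IH => //.
  apply/mnm_lepP => i; have := sm i; have := tm i.
  by rewrite !mnmBE !mnmDE; lia.
have := congr1 mdeg (submK vtm); rewrite mdegD [mdeg (v + t)]mdegD td; lia.
Qed.

Lemma mpow_reduce k m : mpow U k m -> (k * d <= mdeg m)%N ->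
  mpow (fun x => U x /\ mdeg x = d) k m.
Proof.
move=> [s [<- sU sm]].
have [s' [s's s'U]] : exists s', [/\ size s' = size s,
    forall x, x \in s' -> U x /\ (mdeg x <= d)%N & (msum s' <= msum s)%MM].
  elim: s sU {sm} => [|x s IH] sU; first by exists [::]; split; rewrite ?lepm_refl.
  have [|s' [s's s'U s'sum]] := IH; first by move=> y ys; apply: sU; rewrite inE ys orbT.
  have [x' [x'x Ux' x'd]] := satbound_shrink (sU x (mem_head _ _)).
  exists (x' :: s'); split; first by rewrite /= s's.
    by move=> y; rewrite inE => /predU1P [->|/s'U].
  rewrite !msum_cons; apply/mnm_lepP => i; rewrite !mnmDE; apply: leq_add.
    by move/mnm_lepP: x'x.
  by move/mnm_lepP: s'sum.
move=> s'm kd; rewrite -s's; apply: mpow_fill; rewrite ?s's //.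
exact: lepm_trans s'm sm.
Qed.

(* With x_l u = g t for a product g of k elements of U of degree d, either x_l
   divides t, or x_l can be exchanged in g for another variable of t. *)
Lemma satbound_mpow k : satbound (mpow U k) (k * d).
Proof.
move=> u l ul uU ukd.
have [|s [sk sU sm]] := mpow_reduce uU; first by rewrite mdegD; lia.
suff : mpow (fun x => U x /\ mdeg x = d) k u by apply: mpow_sub => x [].
have sd : mdeg (msum s) = (k * d)%N.
  rewrite -sk; elim: s sU {sm sk} => [|x s IH] sU; first by rewrite /msum big_nil mdeg0.
  rewrite msum_cons mdegD /= mulSn IH ?(sU x (mem_head _ _)).2 // => y ys.
  by apply: sU; rewrite inE ys orbT.
set t := (u + U_(l) - msum s)%MM.
have tE i : (t i + msum s i = u i + (l == i))%N.
  by rewrite mnmBE mnmDE mnm1E; move/mnm_lepP: sm => /(_ i); rewrite mnmDE mnm1E; lia.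
have [i ti] : exists i, t i != 0%N.
  apply: neq0_supp; rewrite -mdeg_eq0.
  by have := congr1 mdeg (submK sm); rewrite !mdegD mdeg1 -/t sd; lia.
have [tl|tl] := eqVneq (t l) 0%N; last first.
  exists s; split => //; apply/mnm_lepP => c; have := tE c.
  by case: eqP => [<-|_]; lia.
have il : i != l by apply: contraNneq ti => ->; rewrite tl.
(* [t] divides [x_l u], which involves no variable beyond [l]. *)
have ltil : (i < l)%N.
  rewrite ltn_neqAle (inj_eq val_inj) il leqNgt; apply: contraNN ti => li.
  by have := tE i; rewrite eq_sym (negPf il) (eqP (forall_inP ul i li)); lia.
have [x xs xl] : exists2 x, x \in s & x l != 0%N.
  apply/hasP; apply: contraT; rewrite -all_predC => /allP sl.
  have : msum s l = 0%N.
    rewrite /msum mnm_sumE big_seq big1 // => x /sl /=; rewrite negbK; exact: eqP.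
  by have := tE l; rewrite tl eqxx; lia.
have [Ux xd] := sU x xs.
have lx : (U_(l) <= x)%MM by rewrite lep1mP.
have sE : msum s = (x + msum (rem x s))%MM.
  rewrite -msum_cons /msum; apply: perm_big; exact: perm_to_rem.
(* The exchange stays in [U] by the condition for [d], since [x_l x'] is a multiple of [x]. *)
pose x' := (x - U_(l) + U_(i))%MM.
have x'd : mdeg x' = d.
  by rewrite -xd -[in RHS](submK lx) /x' !mdegD !mdeg1.
have xul : (x <= u + U_(l))%MM by apply: lepm_trans sm; rewrite sE lem_addr.
have Ux' : U x'.
  apply: (Ud (l := l)); rewrite ?x'd //.
    apply: msupDU (ltnW ltil) _; apply: msup_le (lem_subr _ _) _.
    by apply: msup_le xul _; apply: msupDU.
  have -> : (x' + U_(l) = x + U_(i))%MM.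
    by rewrite /x' -addmA [(U_(i) + _)%MM]addmC addmA submK.
  by apply: Uup Ux (lem_addr _ _).
exists (x' :: rem x s); split.
- by rewrite /= size_rem // -sk; case: (s) xs.
- by move=> y; rewrite inE => /predU1P [->|/mem_rem /sU].
rewrite msum_cons; apply/mnm_lepP => c; rewrite mnmDE.
have := tE c; have := mnm_lepP lx c; rewrite sE !mnmDE mnmBE !mnm1E.
case: (l =P c) => [<-|lc]; first by rewrite (negPf il); lia.
by case: (i =P c) => [<-|_] /=; lia.
Qed.

End Satbound.
End MonomialSets.

(** * Regularity of monomial ideals *)

Section MonomialIdeals.
Variables (K : fieldType) (n : nat).
Local Notation S := {mpoly K[n]}.
Local Notation mon := 'X_{1..n}.
Implicit Types (U V : mon -> Prop) (m u v : mon) (d k : nat) (f g : S).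

Definition mideal U : set S := [set f | forall m, f@_m != 0 -> U m]%classic.

Lemma midealX U m : mideal U 'X_[m] <-> U m.
Proof.
split=> [H|Um l]; first by apply: H; rewrite mcoeffX eqxx oner_eq0.
by rewrite mcoeffX; case: (m =P l) => [<-|]; rewrite ?eqxx.
Qed.

Lemma mideal0 U : mideal U 0.
Proof. by move=> m; rewrite mcoeff0 eqxx. Qed.

Lemma midealD U f g : mideal U f -> mideal U g -> mideal U (f + g).
Proof.
move=> Uf Ug m; rewrite mcoeffD; have [->|/Uf //] := eqVneq f@_m 0.
by rewrite add0r; apply: Ug.
Qed.

Lemma mideal_sum U (T : Type) (r : seq T) (F : T -> S) :
  (forall x, mideal U (F x)) -> mideal U (\sum_(x <- r) F x).
Proof.
by move=> H; elim/big_ind: _ => // [|f g]; [exact: mideal0|exact: midealD].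
Qed.

Lemma mcoeffM_neq0 f g m : (f * g)@_m != 0 ->
  exists a b, [/\ f@_a != 0, g@_b != 0 & m = (a + b)%MM].
Proof.
rewrite -mcoeff_msupp => /msuppM_le /allpairsP [[a b] /= [af bg ->]].
by exists a, b; rewrite -!mcoeff_msupp.
Qed.

Lemma midealMl U f g : upclosed U -> mideal U g -> mideal U (f * g).
Proof.
by move=> Uup Ug m /mcoeffM_neq0 [a [b [_ /Ug Ub ->]]]; apply: Uup Ub _; apply: lem_addl.
Qed.

Lemma ideal_gen_mideal U (G : set S) : upclosed U ->
    (forall g, G g -> mideal U g) ->
    (forall m, U m -> exists2 v, (v <= m)%MM & G 'X_[v]) ->
  ideal_gen G = mideal U.
Proof.
move=> Uup GU UG; rewrite predeqE => f; split=> [[N [a [g [Gg ->]]]]|Uf].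
  by apply: mideal_sum => i; apply: midealMl => //; apply: GU.
pose t := in_tuple (msupp f).
have /choice [v vP] (i : 'I_(size (msupp f))) :
    exists v, (v <= tnth t i)%MM /\ G 'X_[v].
  have [|v] := UG (tnth t i); last by exists v.
  by apply: Uf; rewrite -mcoeff_msupp mem_tnth.
exists (size (msupp f)), (fun i => f@_(tnth t i) *: 'X_[tnth t i - v i]),
  (fun i => 'X_[v i]); split=> [i|]; first by case: (vP i).
rewrite [LHS]mpolyE (big_tnth _ _ (msupp f)); apply: eq_bigr => i _.
by rewrite -scalerAl -mpolyXD submK //; case: (vP i).
Qed.

Lemma monomial_idealP (I : set S) : monomial_ideal I ->
  exists2 U, upclosed U & I = mideal U.
Proof.
move=> [M ->]; pose U m := exists2 g, M g & (g <= m)%MM.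
have Uup : upclosed U by move=> m m' [g Mg gm] mm'; exists g => //; apply: lepm_trans mm'.
exists U => //; apply: ideal_gen_mideal => //.
  by move=> _ [m Mm <-]; apply/midealX; exists m; rewrite ?lepm_refl.
by move=> m [g Mg gm]; exists g => //; exists g.
Qed.

Lemma ideal_pow_mideal U k : upclosed U ->
  ideal_pow (mideal U) k = mideal (mpow U k).
Proof.
move=> Uup; apply: ideal_gen_mideal; first exact: mpow_upclosed.
  move=> _ [g gU ->]; elim: k g gU => [|k IH] g gU.
    rewrite big_ord0 => m _; exists [::]; split => //.
    by rewrite /msum big_nil; apply/mnm_lepP => i; rewrite mnm0E.
  rewrite big_ord_recl => m /mcoeffM_neq0 [a [b [/gU Ua bg ->]]].
  apply: mpowS Ua (lem_addr _ _) _; rewrite addmC addmK.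
  by apply: (IH (fun i => g (lift ord0 i))) bg.
move=> m [s [sk sU sm]]; exists (msum s) => //.
exists (fun i : 'I_k => 'X_[nth 0%MM s i]).
  by move=> i; apply/midealX/sU/mem_nth; rewrite sk.
by rewrite /msum (big_nth 0%MM) sk big_mkord mprodXE.
Qed.

Lemma mideal_resolution U : upclosed U ->
  exists F, graded_free_resolution F (mideal U).
Proof.
move=> Uup; apply: ex_resolution; first exact: mideal0.
  by move=> a f g Uf Ug; apply: midealD => //; apply: midealMl.
move=> d f Uf m; rewrite mcoeff_hcomp; case: ifP => _; first exact: Uf.
by rewrite eqxx.
Qed.

(** [betti] takes an arbitrary resolution; one exists, so the default value does not enter, and
    Koszul homology decides vanishing for every choice. *)
Lemma betti_neq0 U (p : nat) (j : int) : upclosed U ->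
  betti (mideal U) p j <> 0%N <-> ~ koszul_vanish (mideal U) j p.
Proof.
move=> Uup; rewrite /betti; case: xgetP => [b ->|no] /=; last first.
  have [F FP] := mideal_resolution Uup.
  by case: (no (tor_dim F p j)); exists F.
by move=> [F FP ->]; rewrite (tor_dim_koszul FP).
Qed.

(** The homotopy preserves coefficients in the ideal: its value at [m] comes from [x_l x^m] in [U],
    where [m] has degree [j - p - 1 >= d]. *)
Lemma satbound_koszul U d (p : nat) (j : int) :
  satbound U d -> d%:Z < j - p%:Z -> koszul_vanish (mideal U) j p.
Proof.
move=> Ud dj z zP zU zz; exists (khom z); split; first exact: gchain_khom.
  move=> t m /mcoeff_khom_neq0 [l [tl ml nz]].
  have [_] := zP _ _ _ nz; rewrite mdegD mdeg1 => E.
  by apply: Ud ml (zU _ _ nz) _; lia.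
(* A constant coefficient at the empty set would force [p = 0] and [j = 0], against [d < j - p]. *)
rewrite kdiff_khom // => b; apply/eqP; apply: contraT => /zP [].
by rewrite cards0 mdeg0 => <-; lia.
Qed.

(** * Koszul cycles that are not boundaries *)

Definition simplex l : {set 'I_n} := [set i : 'I_n | (i <= l)%N].

Definition xchain s u : chain K n 1 :=
  [ffun t : {set 'I_n} => if t == s then 'X_[u]%:M else 0].

Lemma mcoeff_xchain s u t b m :
  (xchain s u t 0 b)@_m = ((t == s) && (u == m))%:R.
Proof.
rewrite ffunE; case: (t == s) => /=; last by rewrite mxE mcoeff0.
by rewrite mxE !ord1 eqxx mulr1n mcoeffX.
Qed.

Lemma mcoeff_xchain_neq0 s u t b m :
  (xchain s u t 0 b)@_m != 0 -> t = s /\ m = u.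
Proof.
by rewrite mcoeff_xchain; case: (t =P s) => [->|_]; case: (u =P m) => [->|_]; rewrite ?eqxx.
Qed.

Lemma card_simplex (l : 'I_n) : #|simplex l| = l.+1.
Proof.
rewrite -sum1_card (eq_bigl (fun i : 'I_n => (i < l.+1)%N)) => [|i]; last by rewrite inE.
by rewrite (big_ord_narrow (ltn_ord l)) sum1_card card_ord.
Qed.

(* The Koszul boundary of x^u e_0 /\ .. /\ e_l; it is not the boundary of a
   chain with coefficients in the ideal since its multidegree u + (1,..,1,0,..,0)
   leaves room for no other (l+1)-chain. *)
Lemma socle_koszul U u (l : 'I_n) : upclosed U -> msup u l -> ~ U u ->
    (forall i : 'I_n, (i <= l)%N -> U (u + U_(i))%MM) ->
  ~ koszul_vanish (mideal U) (mdeg u + l.+1)%:Z l.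
Proof.
move=> Uup ul nUu Uui H; pose y := xchain (simplex l) u.
have yP : gchain (mdeg u + l.+1)%:Z l.+1 (fun=> 0) y.
  move=> t b m /mcoeff_xchain_neq0 [-> ->]; rewrite card_simplex; split=> //.
  by rewrite addr0 PoszD.
have [||w [_ wU zw]] := H (kdiff y) (gchain_kdiff yP); last 1 first.
- move: zw => /ffunP /(_ (simplex l :\ l)) /rowP /(_ 0).
  (* Here [kdiff y] has coefficient 1 or -1. In [kdiff w] the index [i = l] would require [u] in
     [U], and [i > l] a variable that does not divide [x_l x^u]. *)
  move=> /(congr1 (mcoeff (u + U_(l))%MM)) E.
  have : (kdiff y (simplex l :\ l) 0 0)@_(u + U_(l)) != 0.
    rewrite mcoeff_kdiff (bigD1 l) ?inE ?eqxx //= lem_addl addmK.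
    rewrite finset.setD1K ?inE // mcoeff_xchain !eqxx mulr1 big1 ?addr0.
      by rewrite -signr_odd; case: odd; rewrite ?oppr_eq0 oner_eq0.
    move=> i /andP [_ il]; case: ifP => _; last by rewrite mulr0.
    rewrite mcoeff_xchain; case: eqP => [/finset.setP /(_ l)|]; last by rewrite mulr0.
    by rewrite !inE eqxx leqnn orbF eq_sym (negPf il).
  rewrite E => /mcoeff_kdiff_neq0 [i [il iu /wU]].
  move: il; rewrite !inE negb_and negbK => /orP [/eqP ->|]; first by rewrite addmK.
  rewrite -ltnNge => li; move: iu; rewrite lep1mP mnmDE mnm1E.
  by rewrite (eqP (forall_inP ul i li)); case: (l =P i) li => [<-|//]; rewrite ltnn.
- move=> t m /mcoeff_kdiff_neq0 [i [it im /mcoeff_xchain_neq0 [tl mu]]].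
  rewrite -(submK im) mu; apply: Uui.
  by have := setU11 i t; rewrite tl inE.
- exact: kdiff_kdiff.
Qed.

(** A boundary with coefficients in the ideal would involve a monomial of [U] of degree below the
    minimum. *)
Lemma generator_koszul U m : U m -> (forall m', U m' -> (mdeg m <= mdeg m')%N) ->
  ~ koszul_vanish (mideal U) (mdeg m) 0.
Proof.
move=> Um mmin H; pose y := xchain finset.set0 m.
have yP : gchain (mdeg m) 0 (fun=> 0) y.
  by move=> t b u /mcoeff_xchain_neq0 [-> ->]; rewrite cards0 !addr0.
have [||w [_ wU yw]] := H y yP.
- by move=> t u /mcoeff_xchain_neq0 [_ ->].
- exact: kdiff_gchain0 yP.
have : (y finset.set0 0 0)@_m != 0 by rewrite mcoeff_xchain !eqxx oner_eq0.
rewrite yw => /mcoeff_kdiff_neq0 [i [_ im /wU /mmin]].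
by rewrite -{1}(submK im) mdegD mdeg1 addn1 ltnn.
Qed.

(** * Regularity and the condition (P_d) *)

Definition betti_range (I : set S) : set int :=
  [set r | exists i j, betti I i j <> 0%N /\ r = j - i%:Z]%classic.

Lemma betti_range_le U d r : upclosed U -> satbound U d ->
  betti_range (mideal U) r -> r <= d.
Proof.
move=> Uup Ud [i [j [/(betti_neq0 _ _ Uup) nv ->]]]; rewrite leNgt; apply/negP => dj.
exact/nv/(satbound_koszul Ud).
Qed.

Lemma reg_le U d : upclosed U -> satbound U d -> reg (mideal U) <= d.
Proof.
move=> Uup Ud; rewrite /reg; case: xgetP => // r _ [Dr _].
exact: betti_range_le Dr.
Qed.

(** A nonempty range bounded above by [d] has a maximum, so [reg] is not the default; the maximum is
    found as the value at least distance [e] from [d]. *)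
Lemma reg_ge U d r : upclosed U -> satbound U d -> betti_range (mideal U) r ->
  r <= reg (mideal U).
Proof.
move=> Uup Ud Dr.
pose P e := `[< betti_range (mideal U) (d%:Z - e%:Z) >].
have toP s : betti_range (mideal U) s -> exists2 e, P e & s = d%:Z - e%:Z.
  move=> Ds; have sd := betti_range_le Uup Ud Ds; exists `|d%:Z - s|%N; last by lia.
  by apply/asboolP; rewrite (_ : _ - _ = s) //; lia.
have exP : exists e, P e by have [e Pe _] := toP _ Dr; exists e.
rewrite /reg; case: xgetP => [s _ [_]|no]; first exact.
case: (ex_minnP exP) => e /asboolP De emin; case: (no (d%:Z - e%:Z)); split=> // s Ds.
by have [e' /emin le ->] := toP _ Ds; lia.
Qed.

(** A monomial of least degree in [U] gives a Betti number in homological degree 0. The regularity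
    is thus a natural number, as [satbound] needs. *)
Lemma reg_ge0 U d m : upclosed U -> satbound U d -> U m -> 0 <= reg (mideal U).
Proof.
move=> Uup Ud Um.
have exd : exists c, `[< exists2 m, U m & mdeg m = c >].
  by exists (mdeg m); apply/asboolP; exists m.
case: (ex_minnP exd) => c /asboolP [g Ug gc] cmin.
apply: le_trans (reg_ge (r := mdeg g) Uup Ud _) => //.
exists 0, (mdeg g); split; last by rewrite subr0.
apply/betti_neq0 => //; apply: generator_koszul => // m' Um'.
by rewrite gc; apply: cmin; apply/asboolP; exists m'.
Qed.

(** Downward induction on the degree of [u], with [c] bounding its distance below [d]: if [u] were
    not in [U], its multiples by the variables up to [l] would be, and the socle cycle would push
    the regularity above [r]. *)
Lemma satbound_reg U d r : upclosed U -> satbound U d -> reg (mideal U) = r%:Z ->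
  satbound U r.
Proof.
move=> Uup Ud regr.
suff H c u (l : 'I_n) : (d <= mdeg u + c)%N -> msup u l -> U (u + U_(l))%MM ->
    (r <= mdeg u)%N -> U u.
  by move=> u l ul Uul; apply: (H d u l) => //; apply: leq_addl.
elim: c u => [|c IH] u duc ul Uul ru.
  by apply: Ud ul Uul _; rewrite addn0 in duc.
apply: contrapT => nUu.
have Uui (i : 'I_n) : (i <= l)%N -> U (u + U_(i))%MM.
  move=> il; apply: IH; rewrite ?mdegD ?mdeg1; [by lia|exact: msupDU| |by lia].
  by apply: Uup Uul _; rewrite -addmA [(U_(i) + _)%MM]addmC addmA lem_addr.
have : (mdeg u).+1%:Z <= reg (mideal U).
  (* The simplex on [0, .., l] has [l + 1] vertices, so its boundary lies in Koszul degree [l] and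
     contributes the value [mdeg u + 1]. *)
  apply: (reg_ge Uup Ud); exists l, (mdeg u + l.+1)%:Z; split; last by lia.
  by apply/betti_neq0 => //; apply: socle_koszul.
by rewrite regr; lia.
Qed.

(** * Ideals of Borel type *)

Lemma mpow_vars l k v : msup v l -> (k <= mdeg v)%N ->
  mpow (fun m => exists2 i, i \in simplex l & (U_(i) <= m)%MM) k v.
Proof.
elim: k v => [|k IH] v vl kv.
  exists [::]; split => //; rewrite /msum big_nil.
  by apply/mnm_lepP => i; rewrite mnm0E.
have [|i vi] := @neq0_supp _ v; first by rewrite -mdeg_eq0; lia.
have iv : (U_(i) <= v)%MM by rewrite lep1mP.
apply: (mpowS _ iv).
  exists i; rewrite ?lepm_refl // inE leqNgt; apply: contraNN vi => li.
  exact: (forall_inP vl).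
apply: IH; first by apply: msup_le vl; apply: lem_subr.
by have := congr1 mdeg (submK iv); rewrite mdegD mdeg1; lia.
Qed.

(** If [x_l x^g] is in the ideal, the Borel condition puts into it all multiples of [x^g] by
    monomials of large degree in the variables up to [l]. Dickson's lemma leaves finitely many [g]
    for each [l]. *)
Lemma borel_satbound U : upclosed U -> borel_type (mideal U) ->
  exists d, satbound U d.
Proof.
move=> Uup [_ Bor].
have genX (A : set 'I_n) : ideal_gen [set 'X_i | i in A]%classic =
    mideal (fun m => exists2 i, A i & (U_(i) <= m)%MM).
  apply: ideal_gen_mideal.
  - by move=> m m' [i Ai im] mm'; exists i => //; apply: lepm_trans mm'.
  - by move=> _ [i Ai <-]; apply/midealX; exists i; rewrite ?lepm_refl.
  - by move=> m [i Ai im]; exists U_(i)%MM => //; exists i.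
have gens (A : set 'I_n) : upclosed (fun m : mon => exists2 i, A i & (U_(i) <= m)%MM).
  by move=> m m' [i Ai im] mm'; exists i => //; apply: lepm_trans mm'.
have pow (g : mon) (l : 'I_n) : U (g + U_(l))%MM -> exists k, forall v, msup v l ->
    (k <= mdeg v)%N -> U (g + v)%MM.
  move=> Ugl.
  have : ideal_sat (mideal U) (ideal_gen [set 'X_l]%classic) 'X_[g].
    exists 1%N => // h; rewrite (_ : [set 'X_l]%classic = [set 'X_i | i in [set l]]%classic).
      rewrite genX ideal_pow_mideal // => hP m; rewrite mcoeffXM.
      case: ifP => [gm|]; last by rewrite eqxx.
      move=> /hP [s [s1 sU sm]]; apply: Uup Ugl _; case: s s1 sU sm => [//|x [|//]] _ sU.
      have [_ -> lx] := sU x (mem_head _ _); rewrite /msum big_seq1 => xm.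
      apply/mnm_lepP => i; have := mnm_lepP (lepm_trans lx xm) i; have := mnm_lepP gm i.
      by rewrite mnmDE mnmBE; lia.
    by rewrite image_set1.
  rewrite Bor => -[k _ kP]; exists k => v vl kv.
  suff : mideal U ('X_[g] * 'X_[v]) by rewrite -mpolyXD => /midealX.
  apply: kP; rewrite genX ideal_pow_mideal //; apply/midealX.
  by apply: mpow_sub (mpow_vars vl kv) => m [i il im]; exists i => //; rewrite inE in il.
have bound (l : 'I_n) : exists d, forall u, msup u l -> U (u + U_(l))%MM ->
    (d <= mdeg u)%N -> U u.
  have [s [sM sP]] := dickson (fun u => msup u l /\ U (u + U_(l))%MM).
  have /choice [k kP] (g : mon) : exists k, U (g + U_(l))%MM -> forall v, msup v l ->
      (k <= mdeg v)%N -> U (g + v)%MM.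
    have [/pow [k kP]|no] := pselect (U (g + U_(l))%MM); last by exists 0%N.
    by exists k.
  (* The sum is at least each [mdeg g + k g], so the cofactor of [g] in [u] has degree at least
     [k g]. *)
  exists (\sum_(g <- s) (mdeg g + k g))%N => u ul Uul.
  have [g gs gu] := sP u (conj ul Uul); have [_ Ugl] := sM g gs.
  rewrite (big_rem g) //= => le; rewrite -(submK gu) addmC; apply: kP => //.
    by apply: msup_le ul; apply: lem_subr.
  by have := congr1 mdeg (submK gu); rewrite mdegD; lia.
have [d dP] := choice bound; exists (\max_l d l)%N => u l ul Uul le.
by apply: (dP l) => //; apply: leq_trans le; apply: leq_bigmax.
Qed.

End MonomialIdeals.

Theorem corollary1p8 (K : fieldType) (Kinf : infinite_set [set: K]%classic)
    (n : nat) (n_ge2 : (2 <= n)%N) (I : set {mpoly K[n]})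
    (I_borel : borel_type I) (I_neq0 : I <> [set 0%R]%classic)
    (k : nat) (k_gt0 : (0 < k)%N) :
  (reg (ideal_pow I k) <= k%:Z * reg I)%R.
Proof.
have [U Uup IE] := monomial_idealP I_borel.1; subst I.
have [m Um] : exists m, U m.
  apply: contrapT => no; apply: I_neq0; rewrite predeqE => f.
  split=> [Uf|-> ]; last exact: mideal0.
  apply/mpolyP => m; rewrite mcoeff0; apply/eqP; apply: contraT => /Uf Um.
  by case: no; exists m.
have [d Ud] := borel_satbound Uup I_borel.
(* The regularity is a natural number [r], so [satbound] holds with [r] for [I] and with [k * r] for
   [I^k]. *)
have := reg_ge0 K Uup Ud Um; case regE : (reg _) => [r|//] _.
rewrite ideal_pow_mideal // -PoszM; apply: reg_le; first exact: mpow_upclosed.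
exact: (satbound_mpow Uup (satbound_reg Uup Ud regE)).
Qed.
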